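(* Two triangulated polygons (triangulations of the same polygon with $n+3$ labelled vertices, $n\ge 0$) are related by a multiflip if and only if their corresponding $\mathrm{SL}_2$-friezes are related by a rescaling by some factor $\lambda>0$ with $\lambda\neq1$.
   Context: An $\mathrm{SL}_2$-frieze of width $n\ge0$ is a map $A\colon\{(i,j)\in\mathbb{Z}\times\mathbb{Z}:1\le i-j\le n+2\}\to\mathbb{Z}$ with $A_{i+1,i}=A_{i+n+2,i}=1$ for all $i$, $A_{i,j}>0$ for $2\le i-j\le n+1$, and $A_{i,j}A_{i+1,j+1}-A_{i,j+1}A_{i+1,j}=1$ for $2\le i-j\le n+1$. Its quiddity is $\sigma_i=A_{i+1,i-1}$, $i\in\mathbb{Z}$; it is periodic with period $n+3$ and determines $A$. Correspondence: a triangulated polygon is a convex polygon with $N=n+3$ vertices, labelled clockwise by $\mathbb{Z}/N\mathbb{Z}$, together with a triangulation by non-crossing diagonals. It corresponds to the unique $\mathrm{SL}_2$-frieze of width $n$ whose quiddity entry $\sigma_i$ is the number of triangles of the triangulation incident to vertex $i \bmod N$ (this is the Conway–Coxeter bijection between triangulated labelled $(n+3)$-gons and $\mathrm{SL}_2$-friezes of width $n$). Rescaling (defined for odd width $n$ only): for $\lambda>0$, the rescaling of $A$ by a factor of $\lambda$ is the array $A'$ with $A'_{i,j}=A_{i,j}$ if $i-j$ is odd and $A'_{i,j}=\lambda^{(-1)^{i+1}}A_{i,j}$ if $i-j$ is even. Two $\mathrm{SL}_2$-friezes are related by a rescaling if one is the rescaling of the other. A triangulated polygon is 2-multiflipative if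 it can be partitioned (along diagonals of the triangulation) into triangulated quadrilaterals such that the vertices around the triangulated polygon alternate between those that are incident to a diagonal of a quadrilateral (the diagonal of the triangulation inside a quadrilateral of the partition) and those that are not. A multiflip of a 2-multiflipative triangulated polygon preserves the quadrilaterals and replaces the diagonal within each quadrilateral by the other possible diagonal. A triangulated polygon is 3-multiflipative if it can be partitioned (along diagonals of the triangulation) into triangulated hexagons so that each hexagon has an internal triangle (a triangle formed by three diagonals of the hexagon) and the vertices around the triangulated polygon alternate between those that are incident to a diagonal in a hexagon (a side of an internal triangle) and those that are not. A multiflip of such a triangulated polygon preserves the hexagons and replaces the internal triangle within each hexagon by the other possible internal triangle. Two triangulated polygons are related by a multiflip if one is obtained from the other by a multiflip of either kind; vertex labels are kept fixed. *)

(* Defs.v *)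
From mathcomp Require Import all_boot all_order all_algebra.
From mathcomp Require Import reals.

Set Implicit Arguments.
Unset Strict Implicit.
Unset Printing Implicit Defensive.

Import Order.TTheory GRing.Theory Num.Theory.
Local Open Scope ring_scope.

(* Only the values A i j with 1 <= i - j <= n + 2 are meaningful; values outside
   of this strip are junk, and every statement below ignores them. *)
Definition in_strip (n : nat) (i j : int) : bool := 1 <= i - j <= n%:Z + 2.

Definition SL2_frieze (n : nat) (A : int -> int -> int) : Prop :=
  [/\ forall i : int, A (i + 1) i = 1,
      forall i : int, A (i + n%:Z + 2) i = 1,
      forall i j : int, 2 <= i - j <= n%:Z + 1 -> 0 < A i j
    & forall i j : int, 2 <= i - j <= n%:Z + 1 ->
        A i j * A (i + 1) (j + 1) - A i (j + 1) * A (i + 1) j = 1].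

Definition quiddity (A : int -> int -> int) (i : int) : int :=
  A (i + 1) (i - 1).

Definition rescaling (R : realType) (lam : R) (A : int -> int -> int)
    (i j : int) : R :=
  if (2 %| i - j)%Z then lam ^ ((-1 : int) ^ (i + 1)) * (A i j)%:~R
  else (A i j)%:~R.

Definition is_rescaling (R : realType) (n : nat) (lam : R)
    (A A' : int -> int -> int) : Prop :=
  odd n /\ forall i j : int, in_strip n i j -> (A' i j)%:~R = rescaling lam A i j.

Definition rescaling_related (R : realType) (n : nat) (lam : R)
    (A B : int -> int -> int) : Prop :=
  is_rescaling n lam A B \/ is_rescaling n lam B A.

Section Polygon.
Variable n : nat.

(* The vertices of the (n + 3)-gon, in clockwise order, with addition mod n + 3. *)
Notation vertex := ('I_n.+3).

(* x lies strictly between a and b when going clockwise from a to b: the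
   representatives of x - a and b - a in [0, n + 2] satisfy 0 < x - a < b - a. *)
Definition between (a x b : vertex) : bool :=
  (0 < nat_of_ord (x - a)%R < nat_of_ord (b - a)%R)%N.

(* A chord is a set of two vertices, a convex subpolygon is its set of vertices;
   the whole polygon is [set: vertex]. *)
Definition sides (P : {set vertex}) : {set {set vertex}} :=
  [set [set a; b] | a in P, b in P & (a != b) && [forall x in P, ~~ between a x b]].

Definition diagonals (P : {set vertex}) : {set {set vertex}} :=
  [set e : {set vertex} | e \subset P & #|e| == 2] :\: sides P.

Definition crossing (e f : {set vertex}) : bool :=
  [exists a : vertex, exists b : vertex, exists c : vertex, exists d : vertex,
    [&& e == [set a; b], f == [set c; d], between a c b & between b d a]].

Definition dissection (D : {set {set vertex}}) : bool :=
  (D \subset diagonals [set: vertex]) &&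
  [forall e in D, forall f in D, ~~ crossing e f].

(* The pieces into which the diagonals of a dissection D cut the polygon: the
   subpolygons bounded by elements of D and sides of the polygon, and not cut
   further by any element of D. *)
Definition pieces (D : {set {set vertex}}) : {set {set vertex}} :=
  [set P : {set vertex} |
    [&& (2 < #|P|)%N, sides P \subset D :|: sides [set: vertex]
      & [disjoint diagonals P & D]]].

Definition partition_into (k : nat) (D : {set {set vertex}}) : bool :=
  dissection D && [forall P in pieces D, #|P| == k].

Definition triangulation (T : {set {set vertex}}) : bool := partition_into 3 T.

Definition triangles_at (T : {set {set vertex}}) (v : vertex) : nat :=
  #|[set t in pieces T | v \in t]|.

(* The cast i%:~R is reduction of the integer i mod n + 3. *)
Definition corresponds (T : {set {set vertex}}) (A : int -> int -> int) : Prop :=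
  SL2_frieze n A /\ forall i : int, quiddity A i = (triangles_at T i%:~R)%:Z.

(* The vertices incident to a diagonal of T lying inside a piece of D. *)
Definition incident (T D : {set {set vertex}}) : {set vertex} :=
  \bigcup_(P in pieces D) cover (diagonals P :&: T).

Definition alternating (S : {set vertex}) : bool :=
  [forall v : vertex, (v \in S) == (v + 1 \notin S)].

(* T is 2-multiflipative when some D satisfies this; D is the set of diagonals
   along which T is cut into quadrilaterals. *)
Definition two_multiflipative_via (T D : {set {set vertex}}) : bool :=
  [&& D \subset T, partition_into 4 D & alternating (incident T D)].

Definition two_multiflip (T T' : {set {set vertex}}) : Prop :=
  exists2 D, two_multiflipative_via T D &
    T' = D :|: \bigcup_(Q in pieces D) (diagonals Q :\: T).

(* A hexagon P has exactly two internal triangles, and the sides of one cross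
   the sides of the other, so that at most one of them is in a triangulation. *)
Definition internal_triangles (P : {set vertex}) : {set {set vertex}} :=
  [set t : {set vertex} |
    [&& t \subset P, #|t| == 3 & sides t \subset diagonals P]].

Definition three_multiflipative_via (T D : {set {set vertex}}) : bool :=
  [&& D \subset T, partition_into 6 D,
      [forall H in pieces D,
        exists t in internal_triangles H, sides t \subset T]
    & alternating (incident T D)].

Definition three_multiflip (T T' : {set {set vertex}}) : Prop :=
  exists2 D, three_multiflipative_via T D &
    T' = D :|: \bigcup_(H in pieces D)
                 \bigcup_(t in internal_triangles H | ~~ (sides t \subset T))
                   sides t.

Definition multiflip (T T' : {set {set vertex}}) : Prop :=
  two_multiflip T T' \/ three_multiflip T T'.

Definition multiflip_related (T T' : {set {set vertex}}) : Prop :=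
  multiflip T T' \/ multiflip T' T.

End Polygon.

(* Main.v *)
Require Import Defs.
From mathcomp Require Import all_boot all_order all_algebra.
From mathcomp Require Import reals.
From mathcomp Require Import zify ring.

(* Think of A i j as the length of the chord joining the vertices i and j.
   Lengths satisfy Ptolemy's relation, and a chord has length 1 exactly when it
   is a side of the polygon or belongs to the triangulation.

   Rescaling fixes the lengths of the chords whose ends have opposite parity, so
   two triangulations T1, T2 related by a rescaling share their diagonals of this
   kind and no others; let D be the set of common diagonals and S the parity class
   on which the quiddity of the first frieze is multiplied by 1 / mu, where
   mu = max (lam, 1 / lam). In a piece P of D all diagonals join vertices of equal
   parity, hence every side of P belongs to a triangle which cuts off a vertex of
   P. A vertex cut off in T1 lies outside S, a vertex cut off in T2 lies in S; so
   T1 cuts off all vertices of P outside S and T2 all those in S. The lengths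
   between next-to-adjacent vertices of P are therefore alternately 1 and mu in
   the first frieze, and such a sequence closes up only if mu = 2 and P is a
   quadrilateral, or mu = 3 and P is a hexagon.

   Conversely, when a triangulation T cuts off in each piece of D the vertices
   outside S, the number of triangles at v is the number of pieces of D at v,
   multiplied by 2 or 3 when v is in S; a multiflip exchanges S and its
   complement, and a frieze is determined by its quiddity. *)

Set Implicit Arguments.
Unset Strict Implicit.
Unset Printing Implicit Defensive.

Import Order.TTheory GRing.Theory Num.Theory.
Local Open Scope ring_scope.

(** * Cyclic order *)

Section Cyclic.
Variable n : nat.
Notation V := 'I_n.+3.
Implicit Types (a b c p q r s x y z v : V) (P Q : {set V}) (D T : {set {set V}}).

Lemma val_subE a b :
  nat_of_ord (b - a) = (if a <= b then b - a else b + n.+3 - a)%N.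
Proof.
have [ha hb] := (ltn_ord a, ltn_ord b).
rewrite /= modnDmr; case: leqP => h.
  by rewrite addnBA ?(ltnW ha)// addnC -addnBA// modnDl modn_small //; lia.
by rewrite modn_small; lia.
Qed.

Lemma val_succE a : nat_of_ord (a + 1) = (if a == n.+2 :> nat then 0 else a.+1)%N.
Proof.
have ha := ltn_ord a; rewrite /= modnDmr addn1.
by case: eqP => [->|h]; rewrite ?modnn // modn_small //; lia.
Qed.

Lemma betweenE a x b :
  between a x b = [|| a < x < b, x < b < a | b < a < x]%N.
Proof.
rewrite /between !val_subE.
have := (ltn_ord a, ltn_ord b, ltn_ord x); case=> -[].
case: (leqP a x); case: (leqP a b); lia.
Qed.

Lemma vertex_eqE a b : (a == b) = (nat_of_ord a == nat_of_ord b).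
Proof. by []. Qed.

End Cyclic.

Section BasePoint.
Variables (n : nat) (o : 'I_n.+3).
Implicit Types a x b : 'I_n.+3.

(** Clockwise distance from [o]: cutting the circle open at [o] turns the cyclic order into the
    linear order of these values. *)
Definition pos a : nat := nat_of_ord (a - o).

Lemma between_pos a x b :
  between a x b = [|| pos a < pos x < pos b, pos x < pos b < pos a
                    | pos b < pos a < pos x]%N.
Proof.
rewrite betweenE /pos !val_subE.
have := (ltn_ord a, ltn_ord x, ltn_ord b, ltn_ord o); case=> -[[]].
by do 3?[case: ifP]; lia.
Qed.

Lemma pos_base : pos o = 0%N.
Proof. by rewrite /pos subrr. Qed.

Lemma betweenP a x b : between a x b <->
  ((pos a < pos x /\ pos x < pos b) \/ (pos x < pos b /\ pos b < pos a)
   \/ (pos b < pos a /\ pos a < pos x))%coq_nat.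
Proof. by rewrite between_pos; split; lia. Qed.

Lemma betweenlP x b : between o x b <-> (0 < pos x /\ pos x < pos b)%coq_nat.
Proof. by rewrite between_pos pos_base; split; lia. Qed.

Lemma betweenmP a b : between a o b <-> (0 < pos b /\ pos b < pos a)%coq_nat.
Proof. by rewrite between_pos pos_base; split; lia. Qed.

Lemma betweenrP a x : between a x o <-> (0 < pos a /\ pos a < pos x)%coq_nat.
Proof. by rewrite between_pos pos_base; split; lia. Qed.

Lemma not_betweenP a x b : ~~ between a x b <->
  ((pos x <= pos a \/ pos b <= pos x) /\ (pos b <= pos x \/ pos a <= pos b)
   /\ (pos a <= pos b \/ pos x <= pos a))%coq_nat.
Proof. by rewrite between_pos; split; lia. Qed.

Lemma not_betweenlP x b : ~~ between o x b <-> (pos x = 0 \/ pos b <= pos x)%coq_nat.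
Proof. by rewrite between_pos pos_base; split; lia. Qed.

Lemma not_betweenmP a b : ~~ between a o b <-> (pos b = 0 \/ pos a <= pos b)%coq_nat.
Proof. by rewrite between_pos pos_base; split; lia. Qed.

Lemma not_betweenrP a x : ~~ between a x o <-> (pos a = 0 \/ pos x <= pos a)%coq_nat.
Proof. by rewrite between_pos pos_base; split; lia. Qed.

Lemma vertex_eqP a b : a == b <-> pos a = pos b.
Proof.
rewrite /pos; split=> [/eqP->//|/val_inj/eqP].
by rewrite (inj_eq (addIr _)).
Qed.

Lemma vertex_neqP a b : a != b <-> (pos a < pos b \/ pos b < pos a)%coq_nat.
Proof.
split=> [/negP ne|lt]; last by apply/negP => /vertex_eqP; lia.
have : pos a <> pos b by move/vertex_eqP.
by lia.
Qed.

Lemma vertex_neqlP b : o != b <-> (0 < pos b)%coq_nat.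
Proof. by rewrite vertex_neqP pos_base; split; lia. Qed.

Lemma vertex_neqrP a : a != o <-> (0 < pos a)%coq_nat.
Proof. by rewrite vertex_neqP pos_base; split; lia. Qed.

End BasePoint.

(* Taking [o] as origin removes most of the case analysis on the cyclic order. *)
Ltac cyc o :=
  intros;
  try match goal with
  | |- is_true _ => apply: contraT; intro
  | |- @eq (ordinal _) _ _ => apply/eqP; apply: contraT; intro
  end;
  repeat match goal with
  | H : is_true (~~ (_ || _)) |- _ => rewrite negb_or in H
  | H : is_true (~~ (_ && _)) |- _ => rewrite negb_and in H
  | H : is_true (~~ ~~ _) |- _ => rewrite negbK in H
  | H : is_true (_ && _) |- _ => case/andP: H; intros
  | H : is_true (_ || _) |- _ => case/orP: H; intros
  end;
  repeat match goal with
  | H : is_true (between o _ _) |- _ => move/betweenlP: H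
  | H : is_true (between _ o _) |- _ => move/betweenmP: H
  | H : is_true (between _ _ o) |- _ => move/betweenrP: H
  | H : is_true (between _ _ _) |- _ => move/(betweenP o): H
  | H : is_true (~~ (between o _ _)) |- _ => move/not_betweenlP: H
  | H : is_true (~~ (between _ o _)) |- _ => move/not_betweenmP: H
  | H : is_true (~~ (between _ _ o)) |- _ => move/not_betweenrP: H
  | H : is_true (~~ between _ _ _) |- _ => move/(not_betweenP o): H
  | H : is_true (~~ (o == _)) |- _ => move/vertex_neqlP: H
  | H : is_true (~~ (_ == o)) |- _ => move/vertex_neqrP: H
  | H : is_true (~~ (_ == _)) |- _ => move/(vertex_neqP o): H
  | H : is_true (_ == _) |- _ => move/(vertex_eqP o): H
  | H : @eq (ordinal _) ?a ?b |- _ => move/(congr1 (pos o)): H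
  end;
  rewrite ?(pos_base o);
  repeat match goal with H : ?T |- _ =>
    match type of T with Prop => clear H end end;
  repeat match goal with |- context [pos o ?a] =>
    generalize (pos o a); intro end;
  lia.

(** * Sides, diagonals and non-crossing chords *)

Section Pieces.
Variable n : nat.
Notation V := 'I_n.+3.
Implicit Types (a b c p q r s x y z v : V) (P Q : {set V}) (D T : {set {set V}}).

Lemma succ_neq a : a + 1 != a.
Proof. by have := ltn_ord a; rewrite vertex_eqE val_succE; case: ifP; lia. Qed.

Lemma between_succ a x : between a x (a + 1) = false.
Proof.
have := (ltn_ord a, ltn_ord x); rewrite betweenE val_succE.
by case=> -[]; case: ifP; lia.
Qed.

Lemma between_succl a b : b != a -> b != a + 1 -> between a (a + 1) b.
Proof.
have := (ltn_ord a, ltn_ord b); rewrite betweenE !vertex_eqE val_succE.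
by case=> -[]; case: ifP; lia.
Qed.

Lemma set2_inj a b c d :
  [set a; b] = [set c; d] -> (a = c /\ b = d) \/ (a = d /\ b = c).
Proof.
move=> e.
have: a \in [set c; d] by rewrite -e set21.
have: b \in [set c; d] by rewrite -e set22.
have: c \in [set a; b] by rewrite e set21.
have: d \in [set a; b] by rewrite e set22.
rewrite !inE => /orP[]/eqP-> /orP[]/eqP-> /orP[]/eqP h1 /orP[]/eqP h2; subst; auto.
Qed.

(** A side of [P] with its clockwise orientation: the other vertices of [P] lie on the arc from [q]
    to [p]. *)
Definition consec P p q :=
  [&& p \in P, q \in P, p != q & [forall x in P, ~~ between p x q]].

Lemma consecP P p q :
  reflect [/\ p \in P, q \in P, p != q & forall x, x \in P -> ~~ between p x q]
          (consec P p q).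
Proof. by apply: (iffP and4P) => -[? ? ?] /forall_inP. Qed.

Lemma sidesP P e :
  reflect (exists a b, consec P a b /\ e = [set a; b]) (e \in sides P).
Proof.
apply: (iffP imset2P) => [[a b aP]|[a [b [/and4P[aP bP ab h] ->]]]].
  by rewrite !inE => /and3P[bP ab h] ->; exists a, b; rewrite /consec aP bP ab.
by exists a b => //; rewrite !inE bP ab.
Qed.

Lemma mem_sides P a b : ([set a; b] \in sides P) = consec P a b || consec P b a.
Proof.
apply/sidesP/orP => [[c [d [h]]]|].
  by case/set2_inj=> -[-> ->]; [left|right].
by case=> h; [exists a, b|exists b, a; rewrite setUC].
Qed.

Lemma consecT a b : consec [set: V] a b = (b == a + 1).
Proof.
apply/consecP/eqP => [[_ _ ab h]|->].
  apply/eqP; apply: contraT => nb; have := h (a + 1) (in_setT _).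
  by rewrite between_succl // 1?eq_sym.
split=> [|||x _]; rewrite ?in_setT ?between_succ //.
by rewrite eq_sym succ_neq.
Qed.

Lemma mem_sidesT a b :
  ([set a; b] \in sides [set: V]) = (b == a + 1) || (a == b + 1).
Proof. by rewrite mem_sides !consecT. Qed.

Lemma mem_diagonals P a b :
  ([set a; b] \in diagonals P) =
  [&& a \in P, b \in P, a != b, ~~ consec P a b & ~~ consec P b a].
Proof.
rewrite inE mem_sides negb_or inE cards2 subUset !sub1set.
by case: (a \in P); case: (b \in P); case: (a != b); rewrite /= ?andbF ?andbT.
Qed.

Lemma diagonals_pair P e : e \in diagonals P ->
  exists a b, [/\ e = [set a; b], a \in P, b \in P & a != b].
Proof.
rewrite !inE => /andP[_ /andP[sub /cards2P[a [b [ab e2]]]]].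
by move: sub; rewrite e2 subUset !sub1set => /andP[aP bP]; exists a, b.
Qed.

Lemma diag_between P a b : [set a; b] \in diagonals P ->
  (exists2 x, x \in P & between a x b) /\ (exists2 x, x \in P & between b x a).
Proof.
rewrite mem_diagonals => /and5P[aP bP ab]; rewrite /consec aP bP ab eq_sym ab /=.
by move=> /forall_inPn[x xP /negPn hx] /forall_inPn[y yP /negPn hy]; split; [exists x|exists y].
Qed.

Lemma between_diag P a b x y : a \in P -> b \in P -> x \in P -> y \in P ->
  between a x b -> between b y a -> [set a; b] \in diagonals P.
Proof.
move=> aP bP xP yP hx hy; rewrite mem_diagonals aP bP /=; apply/and3P; split.
- by cyc a.
- by apply/negP => /consecP[_ _ _ /(_ x xP)]; rewrite hx.
- by apply/negP => /consecP[_ _ _ /(_ y yP)]; rewrite hy.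
Qed.

Lemma dissectionP D : reflect
  [/\ forall e, e \in D -> exists a b, e = [set a; b],
      forall a b, [set a; b] \in D -> [&& a != b, b != a + 1 & a != b + 1]
    & forall a b c d, [set a; b] \in D -> [set c; d] \in D ->
      between a c b -> ~~ between b d a]
  (dissection D).
Proof.
apply: (iffP andP) => [[/subsetP sD /forall_inP cD]|[h1 h2 h3]]; split.
- by move=> e /sD/diagonals_pair[a [b [-> _ _ _]]]; exists a, b.
- by move=> a b /sD; rewrite mem_diagonals !consecT => /and5P[_ _ -> -> ->].
- move=> a b c d abD cdD hc; apply/negP=> hd.
  have /forall_inP/(_ _ cdD)/existsP := cD _ abD.
  by case; exists a; apply/existsP; exists b; apply/existsP; exists c;
    apply/existsP; exists d; rewrite !eqxx hc hd.
- apply/subsetP=> e eD; have [a [b e2]] := h1 e eD; move: eD; rewrite e2 => /h2.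
  by rewrite mem_diagonals !consecT !in_setT.
- apply/forall_inP => e eD; apply/forall_inP => f fD; apply/existsPn => a.
  apply/existsPn => b; apply/existsPn => c; apply/existsPn => d.
  apply/negP => /and4P[/eqP e2 /eqP f2 hc]; move: eD fD; rewrite e2 f2 => eD fD.
  by apply/negP; apply: h3 eD fD hc.
Qed.

Lemma dissection_nc D a b c d : dissection D -> [set a; b] \in D ->
  [set c; d] \in D -> between a c b -> between b d a -> False.
Proof. by case/dissectionP => _ _ h abD cdD hc hd; have := h _ _ _ _ abD cdD hc; rewrite hd. Qed.

Lemma dissection_neq D a b : dissection D -> [set a; b] \in D ->
  [&& a != b, b != a + 1 & a != b + 1].
Proof. by case/dissectionP => _ h _; apply: h. Qed.

Lemma dissection_pair D e : dissection D -> e \in D -> exists a b, e = [set a; b].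
Proof. by case/dissectionP => h _ _; apply: h. Qed.

(** The chords that may bound a piece of [D]. When [D] is a triangulation, they turn out to be
    exactly the chords of length 1 in the corresponding frieze. *)
Definition link D a b := [set a; b] \in D :|: sides [set: V].

Lemma linkC D a b : link D a b = link D b a.
Proof. by rewrite /link setUC. Qed.

Lemma linkE D a b : link D a b = [|| [set a; b] \in D, b == a + 1 | a == b + 1].
Proof. by rewrite /link inE mem_sidesT. Qed.

(** A side of the polygon has no vertex on one of its two arcs, so vertices strictly on both arcs
    leave only membership in [D]. *)
Lemma link_between D a b x y : link D a b -> between a x b -> between b y a ->
  [set a; b] \in D.
Proof.
rewrite linkE => /or3P[//|/eqP ->|/eqP ->]; first by rewrite between_succ.
by rewrite (between_succ b).
Qed.

Lemma piecesP D P : reflect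
  [/\ (2 < #|P|)%N, forall p q, consec P p q -> link D p q
    & forall a b, [set a; b] \in D -> [set a; b] \notin diagonals P]
  (P \in pieces D) .
Proof.
rewrite inE; apply: (iffP and3P) => [[h1 /subsetP h2 /pred0P h3]|[h1 h2 h3]]; split=> //.
- by move=> p q h; apply: h2; rewrite mem_sides h.
- by move=> a b abD; have := h3 [set a; b]; rewrite /= abD andbT => ->.
- by apply/subsetP => e /sidesP[a [b [h ->]]]; apply: h2.
- apply/pred0P => e /=; apply/negP => /andP[eP].
  have [a [b [e2 _ _ _]]] := diagonals_pair eP; move: eP; rewrite e2 => eP /h3.
  by rewrite eP.
Qed.

End Pieces.

(** * Pieces of a dissection *)

Section PieceStructure.
Variable n : nat.
Notation V := 'I_n.+3.
Implicit Types (a b c p q r s x y z v : V) (P Q : {set V}) (D T : {set {set V}}).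

Lemma third_vertex P p q : (2 < #|P|)%N -> exists2 z, z \in P & z \notin [set p; q].
Proof.
move=> hP; apply/subsetPn; apply/negP => /subset_leq_card h.
by have := leq_trans hP h; rewrite cards2; case: eqP.
Qed.

Lemma between_total a x b : a != b -> x != a -> x != b -> between a x b || between b x a.
Proof. by cyc a. Qed.

Lemma between_neq a x b : between a x b -> [&& a != b, x != a & x != b].
Proof. by cyc a. Qed.

Lemma consec_next P c x : c \in P -> x \in P -> x != c -> exists q, consec P c q.
Proof.
move=> cP xP xc.
have := @arg_minnP _ x (fun y => (y \in P) && (y != c)) (pos c).
rewrite xP xc => /(_ isT)[] q /andP[qP qc] hq; exists q; apply/consecP; split=> //.
  by rewrite eq_sym.
move=> y yP; apply/negP => hy.
have /and3P[_ yc _] := between_neq hy.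
by have := hq y; rewrite yP yc => /(_ isT); move/betweenlP: hy; lia.
Qed.

Lemma consec_prev P c x : c \in P -> x \in P -> x != c -> exists p, consec P p c.
Proof.
move=> cP xP xc.
have := @arg_maxnP _ x (fun y => (y \in P) && (y != c)) (pos c).
rewrite xP xc => /(_ isT)[] q /andP[qP qc] hq; exists q; apply/consecP; split=> //.
move=> y yP; apply/negP => hy.
have /and3P[_ _ yc] := between_neq hy.
by have := hq y; rewrite yP yc => /(_ isT); move/betweenrP: hy; lia.
Qed.

(** The neighbours of [y] in [y |: P] become consecutive once [y] is removed; the two members [u]
    and [w] make these neighbours distinct. *)
Lemma consec_around P y u w : u \in P -> w \in P -> u != w -> y \notin P ->
  exists p q, consec P p q /\ between p y q.
Proof.
move=> uP wP uw yP.
have uy : u != y by apply: contraNneq yP => <-.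
have [q /consecP[_]] := @consec_next (y |: P) y u (setU11 _ _) (setU1r _ uP) uy.
rewrite in_setU1 eq_sym => /orP[/eqP->|qP]; first by rewrite eqxx.
move=> qy hq.
have [p /consecP[]] := @consec_prev (y |: P) y u (setU11 _ _) (setU1r _ uP) uy.
rewrite in_setU1 => /orP[/eqP->|pP]; first by rewrite eqxx.
move=> _ py hp; exists p, q.
have hu := hq u (setU1r _ uP); have hw := hq w (setU1r _ wP).
have hu' := hp u (setU1r _ uP); have hw' := hp w (setU1r _ wP).
have hqp := hq p (setU1r _ pP).
have wy : w != y by apply: contraNneq yP => <-.
have pq : p != q.
  by cyc y.
have b : between p y q by cyc y.
split=> //; apply/consecP; split=> // x xP; apply/negP => hx.
have xy : x != y by apply: contraNneq yP => <-.
have := hq x (setU1r _ xP); have := hp x (setU1r _ xP).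
by cyc y.
Qed.

Lemma consec_next_uniq P p q q' : consec P p q -> consec P p q' -> q = q'.
Proof.
move=> /consecP[_ qP pq h] /consecP[_ q'P pq' h']; apply/eqP.
have := h _ q'P; have := h' _ qP; cyc p.
Qed.

Lemma consec_prev_uniq P p p' q : consec P p q -> consec P p' q -> p = p'.
Proof.
move=> /consecP[qP _ pq h] /consecP[q'P _ pq' h']; apply/eqP.
have := h _ q'P; have := h' _ qP; cyc q.
Qed.

(** Were [p] missing from [P], it would lie beyond a side of [P]; that side is then in [D] and
    crosses [pq]. *)
Lemma piece_mem_sep D P p q x y : dissection D -> P \in pieces D ->
  [set p; q] \in D -> x \in P -> y \in P -> between p x q -> between q y p -> p \in P.
Proof.
move=> dD pP pqD xP yP hx hy; apply: contraT => np.
have xy : x != y by cyc p.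
have [s [t [st hp]]] := consec_around xP yP xy np.
have /piecesP[_ hl _] := pP; have /consecP[sP tP _ hst] := st.
have hsx := hst x xP; have hsy := hst y yP.
have hq : between t q s by cyc p.
by have := dissection_nc dD (link_between (hl _ _ st) hp hq) pqD hp hq.
Qed.

(** Both ends of [pq] would be vertices of [P], so that [pq] would be a diagonal of the piece [P]
    lying in [D]. *)
Lemma piece_nonsep D P p q x y : dissection D -> P \in pieces D ->
  [set p; q] \in D -> x \in P -> y \in P -> between p x q -> between q y p -> False.
Proof.
move=> dD pP pqD xP yP hx hy.
have pM := piece_mem_sep dD pP pqD xP yP hx hy.
have qM : q \in P by apply: piece_mem_sep dD pP _ yP xP hy hx; rewrite setUC.
have /piecesP[_ _ /(_ _ _ pqD)] := pP.
by rewrite (between_diag pM qM xP yP hx hy).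
Qed.

Lemma piece_gap D P p q x : P \in pieces D -> consec P p q -> between p x q ->
  [set p; q] \in D.
Proof.
move=> /piecesP[cP hl _] pq hx; have /consecP[pP qP npq h] := pq.
have [z zP] := third_vertex p q cP; rewrite !inE negb_or => /andP[zp zq].
have := between_total npq zp zq; rewrite (negPf (h _ zP)) /= => hz.
exact: link_between (hl _ _ pq) hx hz.
Qed.

(* P lies on the arc from p to q, and Q on the arc from q to p. *)
Lemma pieces_sep D P Q : dissection D -> P \in pieces D -> Q \in pieces D -> P != Q ->
  exists p q, [/\ [set p; q] \in D, forall x, x \in P -> ~~ between q x p
    & forall x, x \in Q -> ~~ between p x q].
Proof.
move=> dD.
(* A vertex [y] of [P'] outside [Q'] lies beyond a side [pq] of [Q']. This side is in [D], hence
   does not separate vertices of [P'], and all of [P'] stays on the arc of [y]. *)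
have main P' Q' y : P' \in pieces D -> Q' \in pieces D -> y \in P' -> y \notin Q' ->
  exists p q, [/\ [set p; q] \in D, forall x, x \in P' -> ~~ between q x p
    & forall x, x \in Q' -> ~~ between p x q].
  move=> pP pQ yP yQ; have /piecesP[cQ _ _] := pQ.
  have [u uQ _] := third_vertex y y cQ; have [w wQ] := third_vertex u u cQ.
  rewrite setUid inE eq_sym => uw.
  have [p [q [pq hy]]] := consec_around uQ wQ uw yQ.
  have pqD := piece_gap pQ pq hy; exists p, q; have /consecP[_ _ _ h] := pq; split=> // x xP.
  by apply/negP => hx; have := piece_nonsep dD pP pqD yP xP hy hx.
move=> pP pQ; rewrite eqEsubset negb_and => /orP[]/subsetPn[y y1 y2].
  exact: main pP pQ y1 y2.
by have [p [q [h1 h2 h3]]] := main _ _ _ pQ pP y1 y2; exists q, p; rewrite setUC.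
Qed.

(** The chord of [D] that separates two distinct pieces leaves them at most its two ends in common.
    A common diagonal would be this chord, but no diagonal of a piece is in [D]. *)
Lemma diag_piece_uniq D P Q e : dissection D -> P \in pieces D -> Q \in pieces D ->
  e \in diagonals P -> e \in diagonals Q -> P = Q.
Proof.
move=> dD pP pQ eP eQ; apply/eqP; apply: contraT => nPQ.
have [p [q [pqD hP hQ]]] := pieces_sep dD pP pQ nPQ.
have [a [b [e2 aP bP ab]]] := diagonals_pair eP.
move: eP eQ; rewrite e2 => eP eQ.
have: [&& a \in Q, b \in Q & [set a; b] \notin D].
  move: eQ; rewrite mem_diagonals => /and5P[-> -> _ _ _] /=.
  by apply/negP => abD; have /piecesP[_ _ /(_ _ _ abD)] := pP; rewrite eP.
case/and3P => aQ bQ /negPf nabD; rewrite -nabD.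
have /and3P[pq _ _] := dissection_neq dD pqD.
have h c : c \in P -> c \in Q -> (c == p) || (c == q).
  move=> /hP h1 /hQ h2; apply: contraT; rewrite negb_or => /andP[c1 c2].
  by have := between_total pq c1 c2; rewrite (negPf h1) (negPf h2).
by move: (h _ aP aQ) (h _ bP bQ) ab => /orP[]/eqP-> /orP[]/eqP->; rewrite ?eqxx // setUC.
Qed.

Definition noncross D a b :=
  forall r s, [set r; s] \in D -> between r a s -> between s b r -> False.

Lemma dissection_noncross D a b : dissection D -> link D a b -> noncross D a b.
Proof.
move=> dD hl r s rsD h1 h2.
have r1 : between a s b by cyc a.
have r2 : between b r a by cyc a.
exact: dissection_nc dD rsD (link_between hl r1 r2) h1 h2.
Qed.

(* The vertices which no element of D separates from the chord ab. The pair (a, b)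
   is directed: if ab is itself in D, this is the piece on the side from a to b,
   and if not, it is the piece with ab as a diagonal or side. *)
Definition cell D a b : {set V} := [set x | [forall r, forall s,
  [&& [set r; s] \in D, (r, s) != (a, b) & between r x s] ==>
     (between r a s || between r b s)]].

Lemma cellP D a b x : reflect
  (forall r s, [set r; s] \in D -> (r, s) != (a, b) -> between r x s ->
     between r a s || between r b s) (x \in cell D a b).
Proof.
rewrite inE; apply: (iffP forallP) => [h r s h1 h2 h3|h r].
  by have /forallP/(_ s)/implyP := h r; apply; rewrite h1 h2.
by apply/forallP => s; apply/implyP => /and3P[]; apply: h.
Qed.

Lemma cellPn D a b x : x \notin cell D a b -> exists r s,
  [/\ [set r; s] \in D, (r, s) != (a, b), between r x s, ~~ between r a s
    & ~~ between r b s].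
Proof.
rewrite inE => /forallPn[r /forallPn[s]]; rewrite negb_imply negb_or.
by case/and3P => /and3P[h1 h2 h3] h4 h5; exists r, s.
Qed.

(** The vertex [p + 1] lies in the gap, so it is cut off by some chord of [D]; this chord starts at
    [p], since it does not cut off [p]. The longest such chord [ps] ends at [q]: otherwise [s] lies
    in the gap and is cut off in turn, by a chord which either crosses [ps] or is a longer one from
    [p]. *)
Lemma cell_gap D a b p q : dissection D -> consec (cell D a b) p q -> q != p + 1 ->
  [set p; q] \in D /\ (p, q) != (a, b).
Proof.
move=> dD /consecP[pC qC pq h] qp1.
have hx : between p (p + 1) q by apply: between_succl; rewrite // eq_sym.
have xC : p + 1 \notin cell D a b by apply/negP => /h; rewrite hx.
pose good s := [&& [set p; s] \in D, (p, s) != (a, b), between p (p + 1) s,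
  ~~ between p a s & ~~ between p b s].
have [s0 hs0] : exists s, good s.
  have [r [s [rsD rs hxs ha hb]]] := cellPn xC.
  suff e : r = p by subst r; exists s; rewrite /good rsD rs ha hb hxs.
  apply/eqP; apply: contraT => rp.
  have hp : between r p s.
    have h3 : ~~ between p r (p + 1) by rewrite between_succ.
    by have h4 := succ_neq p; cyc p.
  by have /cellP/(_ _ _ rsD rs hp) := pC; rewrite (negPf ha) (negPf hb).
have [s /and5P[psD ps hxs ha hb] hmax] := arg_maxnP (pos p) hs0.
have nq : ~~ between p q s.
  by apply/negP => hq; have /cellP/(_ _ _ psD ps hq) := qC; rewrite (negPf ha) (negPf hb).
have [->|sq] := eqVneq q s; first by [].
have hsq : between p s q.
  by have := between_neq hxs; cyc p.
have sC : s \notin cell D a b by apply/negP => /h; rewrite hsq.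
have [r' [s' [rsD rs hs ha' hb']]] := cellPn sC.
have np : ~~ between r' p s'.
  by apply/negP => hp; have /cellP/(_ _ _ rsD rs hp) := pC; rewrite (negPf ha') (negPf hb').
have nq' : ~~ between r' q s'.
  by apply/negP => hq; have /cellP/(_ _ _ rsD rs hq) := qC; rewrite (negPf ha') (negPf hb').
have e : r' = p.
  apply/eqP; apply: contraT => rp; exfalso.
  have h1 : between p r' s by cyc p.
  have h2 : between s s' p by cyc p.
  exact: dissection_nc dD psD rsD h1 h2.
subst r'.
have gs' : good s' by rewrite /good rsD rs ha' hb' /= andbT; cyc p.
have [_ /ssrnat.ltP] := (betweenlP p s s').1 hs.
by rewrite ltnNge => /negP[]; exact: hmax.
Qed.

Lemma cell_mem D a b : a \in cell D a b /\ b \in cell D a b.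
Proof. by split; apply/cellP => r s _ _ ->; rewrite ?orbT. Qed.

(** With no vertex of the cell on this arc, [a] and [b] would be consecutive, and [cell_gap]
    excludes [(a, b)] as a gap. *)
Lemma cell_left D a b : dissection D -> a != b -> b != a + 1 ->
  exists2 x, x \in cell D a b & between a x b.
Proof.
move=> dD ab ab1; have [aC bC] := cell_mem D a b.
have [/exists_inP[x xC h]|/exists_inPn h] := boolP [exists x in cell D a b, between a x b].
  by exists x.
have abc : consec (cell D a b) a b by apply/consecP; split.
by have [_] := cell_gap dD abc ab1; rewrite eqxx.
Qed.

Lemma cell_right D a b : dissection D -> a != b -> a != b + 1 -> [set a; b] \notin D ->
  exists2 x, x \in cell D a b & between b x a.
Proof.
move=> dD ab ab1 abD; have [aC bC] := cell_mem D a b.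
have [/exists_inP[x xC h]|/exists_inPn h] := boolP [exists x in cell D a b, between b x a].
  by exists x.
have abc : consec (cell D a b) b a by apply/consecP; rewrite eq_sym; split.
by have [] := cell_gap dD abc ab1; rewrite setUC (negPf abD).
Qed.

Lemma cell_piece D a b : dissection D -> a != b -> b != a + 1 -> noncross D a b ->
  cell D a b \in pieces D.
Proof.
move=> dD ab ab1 nab; have [aC bC] := cell_mem D a b.
apply/piecesP; split.
- have [x xC hx] := cell_left dD ab ab1.
  have /and3P[_ xa xb] := between_neq hx.
  have : [set x; a; b] \subset cell D a b by rewrite !subUset !sub1set xC aC bC.
  by move/subset_leq_card; apply: leq_trans; rewrite -setUA cardsU1 cards2 !inE (negPf xa) (negPf xb) ab.
- move=> p q pq; rewrite linkE; have [->|q1] := eqVneq q (p + 1); first by rewrite orbT.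
  by have [-> _] := cell_gap dD pq q1.
(* A diagonal [pq] of the cell that is in [D] has vertices of the cell on both arcs, so each arc
   contains [a] or [b] and [pq] separates them. If [pq] is [ab] itself, the direction not exempted
   in [cell] already gives a contradiction. *)
- move=> p q pqD; apply/negP => /diag_between[[x xC hx] [y yC hy]].
  have qpD : [set q; p] \in D by rewrite setUC.
  have [e|ne] := eqVneq (p, q) (a, b).
    case: e => ? ?; subst p q; have e : (b, a) != (a, b) by rewrite xpair_eqE negb_and eq_sym ab.
    by have /cellP/(_ _ _ qpD e hy) := yC; cyc a.
  have [e|ne'] := eqVneq (q, p) (a, b).
    case: e => ? ?; subst p q; have e : (b, a) != (a, b) by rewrite xpair_eqE negb_and eq_sym ab.
    by have /cellP/(_ _ _ pqD e hx) := xC; cyc a.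
  have /cellP/(_ _ _ pqD ne hx) := xC; have /cellP/(_ _ _ qpD ne' hy) := yC.
  case/orP=> h1 /orP[]h2; try by cyc p.
    exact: nab qpD h1 h2.
  exact: nab pqD h2 h1.
Qed.

Lemma cell_link D a b x : link D a b -> b != a + 1 -> x \in cell D a b ->
  ~~ between b x a.
Proof.
rewrite linkE => /or3P[abD|/eqP-> /eqP//|/eqP->]; last by rewrite between_succ.
have [<-|ab] := eqVneq a b; first by move=> _ _; cyc a.
move=> _ /cellP/(_ b a); rewrite setUC abD xpair_eqE negb_and eq_sym ab => /(_ isT isT) h.
by apply/negP => /h; cyc a.
Qed.

Lemma dissection_link_neq D a b : dissection D -> link D a b -> a != b.
Proof.
move=> dD; rewrite linkE => /or3P[/(dissection_neq dD)/and3P[]//|/eqP->|/eqP->].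
  by rewrite eq_sym succ_neq.
exact: succ_neq.
Qed.

Lemma piece_on_link D a b : dissection D -> link D a b -> b != a + 1 ->
  exists P, [/\ P \in pieces D, a \in P, b \in P, exists2 x, x \in P & between a x b
    & forall x, x \in P -> ~~ between b x a].
Proof.
move=> dD hl ab1; have ab := dissection_link_neq dD hl.
have [aC bC] := cell_mem D a b; exists (cell D a b); split=> //.
- by apply: cell_piece => //; apply: dissection_noncross.
- exact: cell_left.
- by move=> x; apply: cell_link.
Qed.

Lemma diag_in_piece D a b : dissection D -> a != b -> noncross D a b ->
  ~~ link D a b -> exists2 P, P \in pieces D & [set a; b] \in diagonals P.
Proof.
move=> dD ab nab; rewrite linkE !negb_or => /and3P[abD b1 a1].
have [aC bC] := cell_mem D a b; exists (cell D a b); first exact: cell_piece.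
have [x xC hx] := cell_left dD ab b1; have [y yC hy] := cell_right dD ab a1 abD.
exact: between_diag hx hy.
Qed.

Lemma triangulation_dissection T : triangulation T -> dissection T.
Proof. by case/andP. Qed.

Lemma triangulation_card T P : triangulation T -> P \in pieces T -> #|P| = 3%N.
Proof. by case/andP => _ /forall_inP h /h/eqP. Qed.

(** Otherwise [ab] would be a diagonal of a piece of [T], which then has at least four vertices. *)
Lemma triangulation_maximal T a b : triangulation T -> a != b -> noncross T a b ->
  link T a b.
Proof.
move=> tT ab nab; apply: contraT => nl.
have [P pP hd] := diag_in_piece (triangulation_dissection tT) ab nab nl.
have [[x xP hx] [y yP hy]] := diag_between hd.
have [aP bP] : a \in P /\ b \in P.
  by move: hd; rewrite mem_diagonals => /and5P[].
have u : uniq [:: a; b; x; y].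
  rewrite /= !inE !negb_or; have /and3P[_ xa xb] := between_neq hx.
  have /and3P[_ yb ya] := between_neq hy; rewrite ab (eq_sym a) xa (eq_sym a) ya.
  have xy : x != y by cyc a.
  by rewrite (eq_sym b) xb (eq_sym b) yb xy.
have : (#|[:: a; b; x; y]| <= #|P|)%N.
  by apply/subset_leq_card/subsetP => z; rewrite !inE => /or4P[]/eqP->.
by rewrite (card_uniqP u) (triangulation_card tT pP).
Qed.

End PieceStructure.

(** * Triangles on a chord, and the number of pieces at a vertex *)

Section Counting.
Variable n : nat.
Notation V := 'I_n.+3.
Implicit Types (a b c o p q r s x y z v : V) (P Q : {set V}) (D T : {set {set V}}).

Lemma sub_link D T a b : D \subset T -> link D a b -> link T a b.
Proof. by move=> /subsetP sDT; rewrite !linkE => /orP[/sDT->//|->]; rewrite orbT. Qed.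

Lemma consec_arc P p c : (2 < #|P|)%N -> consec P p c ->
  exists2 z, z \in P & between c z p.
Proof.
move=> cP /consecP[pP cM pc h]; have [z zP] := third_vertex p c cP.
rewrite !inE negb_or => /andP[zp zc]; exists z => //.
by have := between_total pc zp zc; rewrite (negPf (h _ zP)).
Qed.

Lemma triangle_on_link T a b : triangulation T -> link T a b -> b != a + 1 ->
  exists x, [/\ between a x b, link T a x & link T x b].
Proof.
move=> tT hl ab1; have dT := triangulation_dissection tT.
have [Q [pQ aQ bQ [x xQ hx] _]] := piece_on_link dT hl ab1.
have /and3P[ab xa xb] := between_neq hx.
have eQ : Q = [set a; b; x].
  apply/esym/eqP; rewrite eqEcard !subUset !sub1set aQ bQ xQ /=.
  by rewrite (triangulation_card tT pQ) setUC cardsU1 cards2 !inE negb_or xa xb ab.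
have /piecesP[_ hlQ _] := pQ; exists x; split=> //; apply: hlQ; apply/consecP.
- by rewrite eq_sym; split=> // y; rewrite eQ !inE -orbA => /or3P[]/eqP->; cyc a.
- by split=> // y; rewrite eQ !inE -orbA => /or3P[]/eqP->; cyc a.
Qed.

(** If the third vertex of the triangle of [T] on [pc] were not in [P], it would lie beyond a side
    of [P]; this side belongs to [T] and would cross [cx] or [xp]. *)
Lemma apex D T P p c : triangulation T -> dissection D -> D \subset T ->
  P \in pieces D -> consec P p c ->
  exists x, [/\ x \in P, between c x p, link T c x & link T x p].
Proof.
move=> tT dD sDT pP pc; have dT := triangulation_dissection tT.
have /piecesP[cP hl _] := pP.
have [z zP hz] := consec_arc cP pc.
have lT : link T c p by rewrite linkC; apply: sub_link sDT (hl _ _ pc).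
have pc1 : p != c + 1 by apply: contraTneq hz => ->; rewrite between_succ.
have [x [hx cx px]] := triangle_on_link tT lT pc1.
exists x; split=> //; apply: contraT => nxP.
have /consecP[pP' cP' npc h] := pc.
have [r [s [rs hrs]]] := consec_around pP' cP' npc nxP.
have rsT : [set r; s] \in T by move/subsetP: sDT; apply; apply: piece_gap pP rs hrs.
have /consecP[rP sP nrs hr] := rs.
have hc := hr _ cP'; have hp := hr _ pP'; have hz' := hr _ zP; have hz'' := h _ zP.
have [cr|cr] := boolP ((c == r) || (c == s)); last first.
  have h2 : between s c r by cyc r.
  by have := dissection_noncross dT cx (r := s) (s := r); rewrite setUC => /(_ rsT); case.
have [pr|pr] := boolP ((p == r) || (p == s)); last first.
  have h2 : between s p r by cyc r.
  by have := dissection_noncross dT px rsT hrs h2.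
by case/orP: cr => e; case/orP: pr => e'; cyc c.
Qed.

Lemma piece_enum P o : o \in P -> exists f : nat -> V,
  [/\ f 0%N = o, f #|P| = o, forall i, (i < #|P|)%N -> f i \in P,
      forall x, x \in P -> exists2 i, (i < #|P|)%N & x = f i
    & forall i j, (i < j < #|P|)%N -> (pos o (f i) < pos o (f j))%N].
Proof.
move=> oP; pose s := sort (relpre (pos o) leq) (enum P).
have sz : size s = #|P| by rewrite size_sort cardE.
have memE x : (x \in s) = (x \in P) by rewrite mem_sort mem_enum.
have pinj : injective (pos o) by move=> a b e; apply/eqP/(vertex_eqP o).
have us : uniq (map (pos o) s) by rewrite map_inj_uniq // sort_uniq enum_uniq.
have ss : sorted ltn (map (pos o) s).
  rewrite ltn_sorted_uniq_leq us sorted_map.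
  by apply: sort_sorted => a b; apply: leq_total.
have mono i j : (i < j < #|P|)%N -> (pos o (nth o s i) < pos o (nth o s j))%N.
  move=> /andP[ij jP]; rewrite -!(nth_map o 0%N (pos o)) ?sz ?(ltn_trans ij jP) //.
  by apply: (sorted_ltn_nth ltn_trans) => //; rewrite inE size_map sz // (ltn_trans ij jP).
exists (nth o s); split=> //.
- have := oP; rewrite -memE => /(nthP o)[[//|i]]; rewrite sz => iP e.
  by have := mono 0%N i.+1; rewrite iP e pos_base => /(_ isT).
(* The default value [o] of [nth] closes the list up after one turn. *)
- by rewrite nth_default // sz.
- by move=> i iP; rewrite -memE mem_nth // sz.
- by move=> x; rewrite -memE => /(nthP o)[i]; rewrite sz => iP <-; exists i.
Qed.

Lemma card_gt1_neq P o : (1 < #|P|)%N -> exists2 x, x \in P & x != o.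
Proof.
move=> cP; apply/exists_inP; apply: contraTT cP => /exists_inPn h.
rewrite -leqNgt -(cards1 o); apply/subset_leq_card/subsetP => x /h.
by rewrite negbK inE.
Qed.

Lemma enum_consec P o (f : nat -> V) j : (1 < #|P|)%N ->
  f 0%N = o -> f #|P| = o -> (forall i, (i < #|P|)%N -> f i \in P) ->
  (forall x, x \in P -> exists2 i, (i < #|P|)%N & x = f i) ->
  (forall i j, (i < j < #|P|)%N -> (pos o (f i) < pos o (f j))%N) ->
  (j < #|P|)%N -> consec P (f j) (f j.+1).
Proof.
move=> cP f0 fm fP fS mono jP.
have mono' i k : (i <= k < #|P|)%N -> (pos o (f i) <= pos o (f k))%N.
  move=> /andP[]; rewrite leq_eqVlt => /orP[/eqP->//|ik kP].
  by apply/ltnW/mono; rewrite ik.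
have [jm|jm] := eqVneq j.+1 #|P|.
  rewrite jm fm; apply/consecP; split.
  - exact: fP.
  - by rewrite -f0; apply: fP; apply: ltnW.
  - by apply/vertex_neqrP/ssrnat.ltP; rewrite -(pos_base o) -{2}f0; apply: mono; rewrite jP; lia.
  - move=> x /fS[i iP ->]; apply/not_betweenrP; right; apply/ssrnat.leP.
    by apply: mono'; rewrite jP; lia.
have j1 : (j.+1 < #|P|)%N by lia.
apply/consecP; split; try exact: fP.
- by apply/(vertex_neqP o); left; apply/ssrnat.ltP/mono; rewrite ltnSn.
- move=> x /fS[i iP ->]; apply/(not_betweenP o).
  have h : (pos o (f j) < pos o (f j.+1))%N by apply: mono; rewrite ltnSn.
  have [ij|ij] := leqP i j.
    have := mono' i j; rewrite ij jP => /(_ isT); lia.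
  have := mono' j.+1 i; rewrite ij iP => /(_ isT); lia.
Qed.

Definition nbrs D v : {set V} := [set x | [set v; x] \in D].

Lemma in_nbrs D v x : (x \in nbrs D v) = ([set v; x] \in D).
Proof. by rewrite inE. Qed.

Definition next_in P v := if [pick q | consec P v q] is Some q then q else v.

Lemma next_inP P v : v \in P -> (1 < #|P|)%N -> consec P v (next_in P v).
Proof.
move=> vP /(card_gt1_neq v)[x xP xv]; have [q vq] := consec_next vP xP xv.
by rewrite /next_in; case: pickP => // /(_ q); rewrite vq.
Qed.

Lemma piece_card2 D P : P \in pieces D -> (2 < #|P|)%N.
Proof. by case/piecesP. Qed.

(** Sending a piece at [v] to its vertex after [v] is a bijection onto [v + 1 |: nbrs D v]. Each
    such [x] is reached by the piece on the arc from [x] to [v]; two pieces with the same oriented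
    side lie on the same side of it, and no chord of [D] can separate them. *)
Lemma triangles_nbrs D v : dissection D ->
  #|[set P in pieces D | v \in P]| = #|nbrs D v|.+1.
Proof.
move=> dD.
have v1 : v + 1 \notin nbrs D v.
  by rewrite in_nbrs; apply/negP => /(dissection_neq dD)/and3P[_ /eqP].
have -> : #|nbrs D v|.+1 = #|v + 1 |: nbrs D v| by rewrite cardsU1 v1.
have linkv x : x \in v + 1 |: nbrs D v -> link D x v.
  by rewrite in_setU1 in_nbrs linkE => /orP[->|]; rewrite ?orbT // setUC => ->.
rewrite -(card_in_imset (f := fun P => next_in P v)).
  apply: eq_card => x; apply/imsetP/idP => [[P]|xN].
    rewrite inE => /andP[pP vP] ->.
    have h := next_inP vP (ltnW (piece_card2 pP)).
    have /consecP[_ nP _ _] := h.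
    have /piecesP[cP hl _] := pP; have := hl _ _ h.
    rewrite in_setU1 in_nbrs linkE => /or3P[->|->//|/eqP e]; rewrite ?orbT //.
    have [z zP] := consec_arc cP h; rewrite {2}e.
    by rewrite between_succ.
  have lx := linkv _ xN.
  have vx1 : v != x + 1.
    move: xN; rewrite in_setU1 => /orP[/eqP->|].
      rewrite vertex_eqE !val_succE; have := ltn_ord v.
      by do 2?[case: ifP]; lia.
    by rewrite in_nbrs => /(dissection_neq dD)/and3P[].
  have [P [pP xP vP _ h]] := piece_on_link dD lx vx1.
  exists P; first by rewrite inE pP.
  apply/esym/(@consec_next_uniq _ P v); first by apply: next_inP => //; apply: ltnW (piece_card2 pP).
  by apply/consecP; split=> //; rewrite eq_sym (dissection_link_neq dD lx).
move=> P Q /setIdP[pP vP] /setIdP[pQ vQ] e.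
apply/eqP; apply: contraT => nPQ.
have hP := next_inP vP (ltnW (piece_card2 pP)).
have hQ := next_inP vQ (ltnW (piece_card2 pQ)); rewrite -e in hQ.
have [z zP hz] := consec_arc (piece_card2 pP) hP.
have [y yQ hy] := consec_arc (piece_card2 pQ) hQ.
have [p [q [pqD sP sQ]]] := pieces_sep dD pP pQ nPQ.
have /consecP[_ xP nvx hP'] := hP; have /consecP[_ xQ _ hQ'] := hQ.
have /and3P[npq _ _] := dissection_neq dD pqD.
move: (next_in P v) hz hy xP xQ nvx hP' hQ' {hP hQ e} => x hz hy xP xQ nvx _ _.
have := (sP _ vP); have := (sQ _ vQ); have := (sP _ xP); have := (sQ _ xQ).
have := (sP _ zP); have := (sQ _ yQ); cyc v.
Qed.

End Counting.

(** * Lengths of chords *)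

Fixpoint three_term_seq (s : nat -> int) (u0 u1 : int) (k : nat) : int :=
  match k with
  | 0 => u0
  | k1.+1 => match k1 with
             | 0 => u1
             | k2.+1 => s k1 * three_term_seq s u0 u1 k1 - three_term_seq s u0 u1 k2
             end
  end.

(** The determinant of the vectors [v_j] and [v_i], where the coordinates of [v_k] are the solutions
    of the quiddity recurrence that start with 1, 0 and with 0, 1. *)
Definition frieze_det (A : int -> int -> int) (j i : nat) : int :=
  let s k := quiddity A k%:Z in
  three_term_seq s 1 0 j * three_term_seq s 0 1 i -
  three_term_seq s 1 0 i * three_term_seq s 0 1 j.

Lemma frieze_detSS A j i :
  frieze_det A j i.+2 = quiddity A i.+1%:Z * frieze_det A j i.+1 - frieze_det A j i.
Proof. rewrite /frieze_det /=; ring. Qed.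

Lemma frieze_detC A j i : frieze_det A j i = - frieze_det A i j.
Proof. rewrite /frieze_det; ring. Qed.

Lemma frieze_det_succ A j : frieze_det A j j.+1 = 1.
Proof.
elim: j => [|j IH]; first by rewrite /frieze_det /=; ring.
by rewrite frieze_detSS (frieze_detC _ _ j) IH /frieze_det; ring.
Qed.

Lemma frieze_det_plucker A a b c d :
  frieze_det A a c * frieze_det A b d =
  frieze_det A a b * frieze_det A c d + frieze_det A b c * frieze_det A a d.
Proof. rewrite /frieze_det; ring. Qed.

(** By induction on [i - j]: for the indices [j], [j + 1], [i], [i + 1] the Plucker relation is the
    unimodular rule, which determines the next entry since its coefficient is positive. *)
Lemma friezeE n A (j i : nat) : SL2_frieze n A -> (j < i <= n.+2)%N ->
  A i%:Z j%:Z = frieze_det A j i.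
Proof.
case=> h1 h2 h3 h4; move: i; have H : forall k j, (j + k.+1 <= n.+2)%N ->
    A (j + k.+1)%N%:Z j%:Z = frieze_det A j (j + k.+1).
  move=> k; have [m hm] := ubnP k; elim: m k hm => // m IH [|[|k]] hk {}j hj.
  - by rewrite addn1 frieze_det_succ -(h1 j%:Z); congr (A _ _); lia.
  - rewrite addn2 frieze_detSS frieze_det_succ /frieze_det subrr subr0 mulr1.
    by rewrite /quiddity; congr (A _ _); lia.
  have e1 := IH k.+1 (ltac:(lia)) j (ltac:(lia)).
  have e2 := IH k.+1 (ltac:(lia)) j.+1 (ltac:(lia)).
  have e3 := IH k (ltac:(lia)) j.+1 (ltac:(lia)).
  have p := frieze_det_plucker A j j.+1 (j + k.+2) (j + k.+2).+1.
  have := h4 (j + k.+2)%N%:Z j%:Z (ltac:(lia)).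
  have pos : 0 < A (j.+1 + k.+1)%N j.+1.
    case: k {IH e1 e2 p hk} e3 hj => [|k] e3 hj.
      by have := h1 j.+1%:Z; rewrite (_ : j.+1%:Z + 1 = (j.+1 + 1)%N); [move=> -> | lia].
    by apply: h3; lia.
  rewrite (_ : (j + k.+2)%N%:Z + 1 = (j.+1 + k.+2)%N); last by lia.
  rewrite (_ : j%:Z + 1 = j.+1); last by lia.
  move: pos; rewrite e1 e2 (_ : A (j + k.+2)%N j.+1 = A (j.+1 + k.+1)%N j.+1); last by congr (A _ _); lia.
  rewrite e3 => pos.
  rewrite (_ : (j + k.+3)%N = (j.+1 + k.+2)%N); last by lia.
  move: p; rewrite !frieze_det_succ !mul1r.
  rewrite (_ : (j + k.+2).+1 = (j.+1 + k.+2)%N); last by lia.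
  rewrite (_ : (j + k.+2)%N = (j.+1 + k.+1)%N); last by lia.
  move=> -> e; apply: (mulfI (lt0r_neq0 pos)).
  by move: e; move: (_ * frieze_det _ _ _) => u; move: (_ * A _ _) => w; lia.
move=> i /andP[ji iN]; have := H (i - j.+1)%N j.
by rewrite (_ : (j + (i - j.+1).+1)%N = i); [apply | lia].
Qed.

Section Length.
Variables (n : nat) (A : int -> int -> int).
Hypothesis hA : SL2_frieze n A.
Notation V := 'I_n.+3.
Implicit Types a b c p q z : V.

(** With the labels taken in [[0, n + 2]], each chord is read off from a single entry of the strip,
    whose first index is the larger label. *)
Definition len a b : int :=
  if (a < b)%N then A b%:Z a%:Z else if (b < a)%N then A a%:Z b%:Z else 0.

Lemma lenC a b : len a b = len b a.
Proof. by rewrite /len; case: (ltngtP a b). Qed.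

Lemma lenxx a : len a a = 0.
Proof. by rewrite /len ltnn. Qed.

Lemma lenE a b : (a <= b)%N -> len a b = frieze_det A a b.
Proof.
rewrite /len; have hb := ltn_ord b; case: (ltngtP a b) => // [ab _|e _].
  by apply: friezeE hA _; lia.
by rewrite e /frieze_det subrr.
Qed.

(** The side from [n + 2] back to [0] is read off from the far boundary row of the frieze, all
    others from the near one. *)
Lemma len_succ a : len a (a + 1) = 1.
Proof.
have := val_succE a; case: ifP => [/eqP h e|_ e]; last first.
  by rewrite lenE e // frieze_det_succ.
have l0 : (nat_of_ord (a + 1)%R <= a)%N by rewrite e.
have l1 : (0 < a <= n.+2)%N by rewrite h leqnn.
rewrite lenC (lenE l0) e -(friezeE hA l1) h; have [_ h2 _ _] := hA.
by rewrite -(h2 0); congr (A _ _); lia.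
Qed.

Lemma len_gt0 a b : a != b -> 0 < len a b.
Proof.
wlog ab : a b / (a < b)%N => [H ne|_].
  have: (a < b)%N || (b < a)%N by move: ne; rewrite vertex_eqE neq_ltn.
  by case/orP=> h; [apply: H|rewrite lenC; apply: H; rewrite // eq_sym].
have := ltn_ord b; rewrite /len ab => hb.
have [e1|n1] := eqVneq (b : nat) a.+1.
  have [/(_ a%:Z) + _ _ _] := hA.
  by rewrite (_ : A b a = A (a%:Z + 1) a); [move=> -> | congr (A _ _); lia].
have [e2|n2] := eqVneq (b : nat) (a + n.+2)%N.
  have [_ /(_ a%:Z) + _ _] := hA.
  by rewrite (_ : A b a = A (a%:Z + n%:Z + 2) a); [move=> -> | congr (A _ _); lia].
by have [_ _ + _] := hA; apply; lia.
Qed.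

(** The cyclic order [a], [c], [b], [d] allows four linear orders of the labels; in each of them
    this is the Plucker relation. *)
Lemma ptolemy a b c d : between a c b -> between b d a ->
  len a b * len c d = len a c * len b d + len a d * len c b.
Proof.
rewrite !betweenE => h1 h2.
have : [|| [&& a < c, c < b & b < d], [&& c < b, b < d & d < a],
        [&& b < d, d < a & a < c] | [&& d < a, a < c & c < b]]%N by lia.
case/or4P=> /and3P[u v w].
- rewrite !lenE; try lia.
  by rewrite (frieze_det_plucker A a c b d); ring.
- rewrite (lenC a b) (lenC a c) (lenC a d) !lenE; try lia.
  by rewrite mulrC (frieze_det_plucker A c b d a); ring.
- rewrite (lenC a b) (lenC c d) (lenC c b) (lenC a d) !lenE; try lia.
  by rewrite (frieze_det_plucker A b d a c); ring.
- rewrite (lenC c d) (lenC b d) (lenC a d) !lenE; try lia.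
  by rewrite mulrC (frieze_det_plucker A d a c b); ring.
Qed.

Lemma three_term p c q z : between p c q -> z != c -> ~~ between p z q ->
  len p c = 1 -> len c q = 1 -> len z c * len p q = len z p + len z q.
Proof.
move=> h zc hz pc cq; have [->|zp] := eqVneq z p; first by rewrite pc mul1r lenxx add0r.
have [->|zq] := eqVneq z q; first by rewrite (lenC q c) cq mul1r lenxx addr0 lenC.
have h' : between q z p by cyc p.
by rewrite mulrC (lenC z c) (ptolemy h h') pc cq mul1r mulr1 (lenC z q) (lenC z p) addrC.
Qed.

End Length.

(** * Links of a triangulation are the chords of length 1 *)

Section Triangulated.
Variables (n : nat) (A : int -> int -> int) (T : {set {set 'I_n.+3}}).
Notation V := 'I_n.+3.
Hypotheses (tT : triangulation T) (cA : corresponds T A).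
Implicit Types a b c p q x z : V.

Let hA : SL2_frieze n A := cA.1.
Let dT := triangulation_dissection tT.
Notation lenA := (len A).

Lemma intr_vertex c : (nat_of_ord c)%:Z%:~R = c.
Proof. by rewrite -pmulrn Zp_nat valZpK. Qed.

Lemma len_around p c q : p.+1 = c :> nat -> c.+1 = q :> nat ->
  lenA p q = #|nbrs T c|.+1%:Z.
Proof.
move=> pc cq; rewrite -(triangles_nbrs _ dT); have [_ /(_ c%:Z)] := cA.
rewrite intr_vertex /triangles_at => <-; rewrite /len /quiddity.
by case: ltnP => ?; [congr (A _ _); lia | lia].
Qed.

(** For a link [ab] the size of this set is the number of triangles at [a] between [a] and [b]; the
    bound [a.+1 < x] drops the side of the polygon that starts at [a]. *)
Definition nbrs_after a b : {set V} := [set x : V | (a.+1 < x <= b)%N && link T a x].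
Definition nbrs_before a b : {set V} := [set x : V | (a <= x)%N && (x.+1 < b)%N && link T x b].

Lemma link_lin a b : link T a b -> (a.+1 < b)%N -> (0 < a)%N || (b < n.+2)%N ->
  [set a; b] \in T.
Proof.
rewrite linkE !vertex_eqE !val_succE; have hb := ltn_ord b.
by case/or3P=> //; case: ifP; lia.
Qed.

(** No diagonal of [T] from [c] crosses [ab], so all neighbours of [c] lie between [a] and [b]. *)
Lemma nbrs_split a c b : link T a b -> (a < c < b)%N ->
  #|nbrs T c| = (#|nbrs_after c b| + #|nbrs_before a c|)%N.
Proof.
move=> ab /andP[ac cb]; have hb := ltn_ord b.
rewrite -cardsUI (_ : nbrs_after c b :&: nbrs_before a c = set0) ?cards0 ?addn0; last first.
  by apply/setP => x; rewrite !inE; apply/negP; lia.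
apply: eq_card => x; rewrite in_nbrs !inE; have hx := ltn_ord x.
apply/idP/idP => [cx|/orP[]].
- have l : link T c x by rewrite linkE cx.
  rewrite (linkC T x c) l !andbT; have := dissection_neq dT cx.
  rewrite !vertex_eqE !val_succE => h.
  have [h1|/negP h1] := boolP (between x a c && between c b x); last first.
    by move: h h1; rewrite !betweenE; case: ifP; case: ifP; lia.
  case/andP: h1 => h1 h2; have := dissection_noncross dT ab (r := x) (s := c).
  by rewrite setUC => /(_ cx h1 h2).
- by move=> /andP[h l]; apply: link_lin l _ _; lia.
- by move=> /andP[h l]; rewrite setUC; apply: link_lin l _ _; lia.
Qed.

Lemma nbrs_after_step a c b : link T a c -> link T c b -> link T a b ->
  (a < c < b)%N -> #|nbrs_after a b| = #|nbrs_after a c|.+1.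
Proof.
move=> ac cb ab h; have hb := ltn_ord b.
have -> : nbrs_after a b = b |: nbrs_after a c.
  apply/setP => x; rewrite !inE; have [->|xb] := eqVneq x b; first by rewrite ab; lia.
  have := xb; rewrite vertex_eqE => xb'.
  apply/andP/andP => -[h1 l]; split=> //; last by lia.
  have [|cx] := leqP x c; first by lia.
  have axT : [set a; x] \in T by apply: link_lin l _ _; lia.
  by have := dissection_nc dT (link_lin cb (ltac:(lia)) (ltac:(lia))) (c := x) (d := a);
    rewrite setUC !betweenE => /(_ axT); lia.
rewrite cardsU1 inE; have -> : (b <= c)%N = false by lia.
by rewrite andbF.
Qed.

Lemma nbrs_before_step a c b : link T a c -> link T c b -> link T a b ->
  (a < c < b)%N -> #|nbrs_before a b| = #|nbrs_before c b|.+1.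
Proof.
move=> ac cb ab h; have hb := ltn_ord b.
have -> : nbrs_before a b = a |: nbrs_before c b.
  apply/setP => x; rewrite !inE; have [->|xb] := eqVneq x a; first by rewrite ab; lia.
  have := xb; rewrite vertex_eqE => xb'.
  apply/andP/andP => -[h1 l]; split=> //; last by lia.
  have [|cx] := leqP c x; first by lia.
  have axT : [set x; b] \in T by apply: link_lin l _ _; lia.
  by have := dissection_nc dT (link_lin ac (ltac:(lia)) (ltac:(lia))) axT;
    rewrite !betweenE; lia.
rewrite cardsU1 inE; have -> : (c <= a)%N = false by lia.
by [].
Qed.

(* With v_z the vectors such that the length of z w is the determinant of v_z and
   v_w, this says v_(a+1) = v_b + k v_a and v_(b-1) = v_a + k' v_b: both hold for
   the triangles on each side of the apex c over ab, and adding them at c gives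
   v_c = v_a + v_b by the quiddity relation at c. *)
Lemma len_fan m a b : (b - a <= m)%N -> (a < b)%N -> link T a b ->
  [/\ lenA a b = 1,
      forall z a', (z <= a)%N || (b <= z)%N -> a' = a.+1 :> nat ->
        lenA z a' = lenA z b + #|nbrs_after a b|%:Z * lenA z a
    & forall z b', (z <= a)%N || (b <= z)%N -> b'.+1 = b :> nat ->
        lenA z b' = lenA z a + #|nbrs_before a b|%:Z * lenA z b].
Proof.
elim: m a b => [|m IH] a b hm ab lab; first by lia.
have hb := ltn_ord b.
have [e|ne] := eqVneq b (a + 1).
  have e' : b = a.+1 :> nat by move: e => ->; rewrite val_succE; case: ifP; lia.
  split; first by rewrite e len_succ.
    move=> z a' _ ea; have -> : a' = b by apply: val_inj; rewrite /= ea e'.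
    rewrite (_ : nbrs_after a b = set0) ?cards0 ?mul0r ?addr0 //.
    by apply/setP => x; rewrite !inE; lia.
  move=> z b' _ eb; have -> : b' = a by apply: val_inj => /=; lia.
  rewrite (_ : nbrs_before a b = set0) ?cards0 ?mul0r ?addr0 //.
  by apply/setP => x; rewrite !inE; lia.
have [c [hc ac bc]] := triangle_on_link tT lab ne; rewrite linkC in bc.
have acb : (a < c < b)%N by move: hc; rewrite betweenE; lia.
rewrite linkC in bc.
have [e1 f1 g1] := IH a c (ltac:(lia)) (ltac:(lia)) ac.
have [e2 f2 g2] := IH c b (ltac:(lia)) (ltac:(lia)) bc.
have [p pc] : exists p : V, p.+1 = c :> nat.
  have h : (c.-1 < n.+3)%N by lia.
  by exists (Ordinal h) => /=; lia.
have cq : nat_of_ord (c + 1) = c.+1 by rewrite val_succE; case: ifP; lia.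
have cp : c = p + 1 by apply: val_inj; rewrite [RHS]val_succE; case: ifP => /=; lia.
have split z : (z <= a)%N || (b <= z)%N -> lenA z c = lenA z a + lenA z b.
  move=> hz; have bpq : between p c (c + 1) by rewrite betweenE cq; move: hz acb pc cq; clear; lia.
  have nbp : ~~ between p z (c + 1) by rewrite betweenE cq; move: hz acb pc cq; clear; lia.
  have zc : z != c by rewrite vertex_eqE; move: hz acb; clear; lia.
  have := three_term hA bpq zc nbp; rewrite {1}cp !(len_succ hA) => /(_ erefl erefl).
  rewrite (len_around pc (esym cq)) (nbrs_split lab acb).
  have hz2 : (z <= c)%N || (b <= z)%N by move: hz acb; clear; lia.
  have hz1 : (z <= a)%N || (c <= z)%N by move: hz acb; clear; lia.
  rewrite (f2 z (c + 1) hz2 cq) (g1 z p hz1 pc).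
  by rewrite intS PoszD; clear; lia.
have eab : lenA a b = 1 by have := split a; rewrite leqnn lenxx add0r e1 => /(_ isT).
split=> //.
- move=> z a' hz ea; rewrite (f1 z a') ?(nbrs_after_step ac bc lab acb) //; last by lia.
  by rewrite split // intS; ring.
- move=> z b' hz eb; rewrite (g2 z b') ?(nbrs_before_step ac bc lab acb) //; last by lia.
  by rewrite split // intS; ring.
Qed.

Lemma len_link a b : link T a b -> lenA a b = 1.
Proof.
move=> l; have := dissection_link_neq dT l; rewrite vertex_eqE neq_ltn => /orP[]h.
  by have [] := len_fan (leqnn _) h l.
by rewrite lenC; rewrite linkC in l; have [] := len_fan (leqnn _) h l.
Qed.

(** If a diagonal [rs] of [T] crossed [ab], Ptolemy's relation with [rs] of length 1 would write the
    length of [ab] as a sum of two positive integers. *)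
Lemma link_len a b : a != b -> lenA a b = 1 -> link T a b.
Proof.
move=> ab e; apply: triangulation_maximal => // r s rsT h1 h2.
have rs : link T r s by rewrite linkE rsT.
have := ptolemy hA h1 h2; rewrite e (len_link rs) => p.
have h c d : c != d -> 0 < lenA c d by apply: len_gt0.
have /and3P[_ ar a_s] := between_neq h1; have /and3P[_ bs br] := between_neq h2.
have := h _ _ ar; have := h _ _ a_s; have := h _ _ bs; have := h _ _ br.
by move: p; rewrite (lenC A a r) (lenC A b s) (lenC A b r); clear; nia.
Qed.

End Triangulated.

(** * Triangulations related by a rescaling *)

(** The values [x 4 = K * (K - 2)] and [x 6 = K * (K - 1) * (K - 3)] settle [K = 2] and [K = 3]. For
    [K >= 4] the bound [x j.*2 <= 2 * x j.*2.+1] propagates and keeps every later term positive, so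
    the sequence never returns to 0. *)
Lemma alternating_recurrence (x : nat -> int) (K : int) (m : nat) :
  2 <= K -> (2 < m)%N -> ~~ odd m -> x 0%N = 0 -> x 1%N = 1 -> x m = 0 ->
  (forall j, (0 < j < m)%N -> 0 < x j) ->
  (forall j, (j.+1 < m)%N -> x j.+2 = (if odd j then 1 else K) * x j.+1 - x j) ->
  (K = 2 /\ m = 4%N) \/ (K = 3 /\ m = 6%N).
Proof.
move=> K2 m2 em x0 x1 xm xpos rec.
have x2 : x 2%N = K by rewrite rec ?(ltnW m2) //= x0 x1; lia.
have [m4|m4] := eqVneq m 4%N.
  left; split=> //; have := rec 2%N; rewrite m4 => /(_ isT) /=.
  by rewrite -m4 xm (rec 1%N) ?m4 //= x2 x1; nia.
have m5 : (5 < m)%N by move: m2 em m4; clear; lia.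
have x3 : x 3%N = K - 1 by rewrite rec ?(ltn_trans _ m5) //= x2 x1; lia.
have x4 : x 4%N = K * (K - 2) by rewrite rec ?(ltn_trans _ m5) //= x2 x3; ring.
have x5 : x 5%N = K * K - 3 * K + 1 by rewrite rec ?(ltn_trans _ m5) //= x4 x3; ring.
have x6 : x 6%N = K * (K - 1) * (K - 3) by rewrite rec //= x4 x5; ring.
have K3 : 3 <= K by have := xpos 4%N; rewrite x4 (ltnW m5) => /(_ isT); nia.
have [eK|nK] := eqVneq K 3.
  right; split=> //; have [//|m6] := eqVneq m 6%N.
  have := xpos 6%N; rewrite x6 eK (_ : (0 < 6 < m)%N) ?mulr0 ?ltxx => [/(_ isT)//|].
  by move: m5 m6; clear; lia.
have K4 : 4 <= K by move: K3 nK; clear; lia.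
have inv j : (j.*2.+1 < m)%N ->
    [/\ 0 <= x j.*2, x j.*2 <= 2 * x j.*2.+1 & 0 < x j.*2.+1].
  elim: j => [|j IH]; first by rewrite x0 x1.
  rewrite doubleS => hj; have hj' : (j.*2.+1 < m)%N by lia.
  have [h1 h2 h3] := IH hj'.
  have := rec j.*2; have := rec j.*2.+1; rewrite /= odd_double /=.
  move=> /(_ ltac:(lia)) -> /(_ ltac:(lia)) ->.
  by move: h1 h2 h3 K4; clear; split; nia.
have [k ek] : exists k, m = k.+1.*2.
  by exists (m./2.-1); move: em m5; clear; lia.
have [|h1 h2 h3] := inv k; first by rewrite ek; lia.
have := rec k.*2; rewrite odd_double /= -doubleS -ek xm => /(_ ltac:(lia)).
by move: h1 h2 h3 K4; clear; nia.
Qed.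

Section Core.
Variable n : nat.
Notation V := 'I_n.+3.
Implicit Types (a b c o p q r s x y z v : V) (P Q S : {set V}) (D T : {set {set V}}).

(* T cuts off every vertex outside S from the piece of D it lies in. *)
Definition eared T D S := forall P p c q, P \in pieces D ->
  consec P p c -> consec P c q -> c \notin S -> [set p; q] \in T.

(** The common form of both kinds of multiflip: [m] is 4 for quadrilaterals and 6 for hexagons, and
    [S] is the set of vertices incident to the diagonals of [T] inside the pieces. *)
Record multiflip_data (m : nat) (D : {set {set V}}) S (T T' : {set {set V}}) : Prop :=
  MultiflipData {
    md_diss : dissection D;
    md_sub : D \subset T;
    md_sub' : D \subset T';
    md_card : forall P, P \in pieces D -> #|P| = m;
    md_alt : alternating S;
    md_side : forall P p q, P \in pieces D -> consec P p q -> (q \in S) = (p \notin S);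
    md_ear : eared T D S;
    md_ear' : eared T' D (~: S) }.

Lemma alternatingP S : reflect (forall v, (v + 1 \in S) = (v \notin S)) (alternating S).
Proof.
apply: (iffP forallP) => h v; first by rewrite (eqP (h v)) negbK.
by rewrite h negbK.
Qed.

Lemma alternatingC S : alternating S -> alternating (~: S).
Proof. by move/alternatingP => h; apply/alternatingP => v; rewrite !in_setC h. Qed.

Lemma consec_neq2 P p c q : (2 < #|P|)%N -> consec P p c -> consec P c q -> p != q.
Proof.
move=> cP pc cq; have [z zP hz] := consec_arc cP pc.
by have /consecP[_ _ _ /(_ z zP)] := cq; cyc c.
Qed.

Lemma consec2_between P p c q : (2 < #|P|)%N -> consec P p c -> consec P c q ->
  between p c q /\ forall z, z \in P -> z != c -> ~~ between p z q.
Proof.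
move=> cP pc cq; have pq := consec_neq2 cP pc cq.
have /consecP[pP cP' npc h1] := pc; have /consecP[_ qP ncq h2] := cq.
have h3 := h1 _ qP; have h4 := h2 _ pP; split; first by cyc p.
by move=> z zP zc; have h5 := h1 _ zP; have h6 := h2 _ zP; cyc c.
Qed.

Lemma piece_link_consec D P a b : P \in pieces D -> a \in P -> b \in P -> link D a b ->
  a != b -> consec P a b || consec P b a.
Proof.
move=> pP aP bP l ab; apply: contraT; rewrite negb_or => /andP[h1 h2].
have hd : [set a; b] \in diagonals P by rewrite mem_diagonals aP bP ab h1.
have [[x xP hx] [y yP hy]] := diag_between hd.
have /piecesP[_ _ /(_ _ _ (link_between l hx hy))] := pP.
by rewrite hd.
Qed.

Section Half.
Variables (T1 T2 : {set {set V}}) (A1 A2 : int -> int -> int) (S : {set V}).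
Hypotheses (t1 : triangulation T1) (t2 : triangulation T2).
Hypotheses (c1 : corresponds T1 A1) (c2 : corresponds T2 A2).
Hypothesis altS : alternating S.
Hypothesis len_opp : forall a b, (b \in S) = (a \notin S) -> len A2 a b = len A1 a b.
Hypothesis len1_out : forall a b, a \notin S -> b \notin S -> len A1 a b <> 1.
Hypothesis len2_in : forall a b, a \in S -> b \in S -> len A2 a b <> 1.
Notation D := (T1 :&: T2).

Lemma common_dissection : dissection D.
Proof.
have /andP[/subsetP s1 /forall_inP h1] := triangulation_dissection t1.
apply/andP; split; first by apply/subsetP => e /setIP[/s1].
apply/forall_inP => e /setIP[eT _]; apply/forall_inP => f /setIP[fT _].
by have /forall_inP := h1 e eT; apply.
Qed.

Lemma common_link a b : link D a b -> (b \in S) = (a \notin S).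
Proof.
have altP := elimT (alternatingP S) altS.
rewrite linkE => /or3P[/setIP[h1 h2]|/eqP->|/eqP->]; last 2 first.
- exact: altP.
- by rewrite altP negbK.
have l1 : link T1 a b by rewrite linkE h1.
have l2 : link T2 a b by rewrite linkE h2.
case: (boolP (a \in S)) => aS; case: (boolP (b \in S)) => bS //.
  by case: (len2_in aS bS); apply: (len_link t2 c2 l2).
by case: (len1_out aS bS); apply: (len_link t1 c1 l1).
Qed.

(** A link of [T1] between the two classes has length 1 in both friezes, hence is a link of [T2] as
    well. *)
Lemma link_common a b : link T1 a b -> (b \in S) = (a \notin S) -> link D a b.
Proof.
move=> l1 h; have ab := dissection_link_neq (triangulation_dissection t1) l1.
have l2 : link T2 a b by apply: link_len t2 c2 _ _ ab _; rewrite len_opp // (len_link t1 c1 l1).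
move: l1 l2; rewrite !linkE in_setI.
by case: (_ \in T1); case: (_ \in T2); rewrite ?orbT.
Qed.

Lemma common_side P p q : P \in pieces D -> consec P p q -> (q \in S) = (p \notin S).
Proof. by case/piecesP => _ h _ /h; apply: common_link. Qed.

(** Look at the apex [x] of the triangle of [T1] on [pc]. One of [cx] and [xp] joins the two
    classes, so it is common and a side of [P]. If it is [cx], then [x] is [q] and the triangle cuts
    off [c]. *)
Lemma common_eared : eared T1 D S.
Proof.
move=> P p c q pP pc cq cS; have cP := piece_card2 pP.
have pS := common_side pP pc; have qS := common_side pP cq.
suff l : link T1 p q.
  move: l; have altP := elimT (alternatingP S) altS.
  rewrite linkE => /or3P[//|/eqP e|/eqP e]; move: pS qS cS; rewrite e altP;
    by case: (_ \in S); case: (_ \in S).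
have ear_out p' c' q' : consec P p' c' -> consec P c' q' -> link T1 p' q' -> c' \notin S.
  move=> h1 h2 l; apply/negP => c'S.
  have := common_side pP h1; have := common_side pP h2; rewrite c'S => q'S /esym p'S.
  by case: (@len1_out p' q'); rewrite ?q'S ?p'S //; apply: (len_link t1 c1 l).
have [x [xP hx cx xp]] := apex t1 common_dissection (subsetIl T1 T2) pP pc.
have /and3P[_ xc xp'] := between_neq hx.
have /consecP[pM cM _ _] := pc.
have [xS|xS] := eqVneq (x \in S) (c \notin S).
  have := piece_link_consec pP cM xP (link_common cx xS); rewrite eq_sym xc => /(_ isT)/orP[] h.
    by rewrite (consec_next_uniq cq h) linkC.
  by move: xp'; rewrite (consec_prev_uniq pc h) eqxx.
(* In the other case [x] precedes [p], and the link [cx] cuts off [p], which is in [S]; such a link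
   would have length 1 between vertices outside [S]. *)
have xS' : (p \in S) = (x \notin S).
  by move: pS xS cS; case: (p \in S); case: (x \in S); case: (c \in S).
case/orP: (piece_link_consec pP xP pM (link_common xp xS') xp') => h.
  have := ear_out _ _ _ h pc; rewrite linkC => /(_ cx).
  by rewrite -pS (negPf cS).
by move: xc; rewrite (consec_next_uniq pc h) eqxx.
Qed.
End Half.

Section Rescaled.
Variables (R : realType) (mu : R).
Variables (T1 T2 : {set {set V}}) (A1 A2 : int -> int -> int) (S : {set V}).
Hypotheses (t1 : triangulation T1) (t2 : triangulation T2).
Hypotheses (c1 : corresponds T1 A1) (c2 : corresponds T2 A2).
Hypothesis altS : alternating S.
Hypothesis mu1 : 1 < mu.
Hypothesis len_opp : forall a b, (b \in S) = (a \notin S) -> len A2 a b = len A1 a b.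
Hypothesis len_in : forall a b, a \in S -> b \in S ->
  (len A2 a b)%:~R = mu * (len A1 a b)%:~R.
Hypothesis len_out : forall a b, a \notin S -> b \notin S ->
  (len A1 a b)%:~R = mu * (len A2 a b)%:~R.
Notation D := (T1 :&: T2).

Lemma scaled_neq1 (x y : int) : 0 <= x -> y%:~R = mu * x%:~R -> y <> 1.
Proof.
move=> x0 + y1; rewrite y1 mulr1z; have [->|xn] := eqVneq x 0.
  by rewrite mulr0z mulr0 => /eqP; rewrite oner_eq0.
have : 1 <= x by lia.
rewrite -(ler_int R) mulr1z => x1 e.
have : mu <= mu * x%:~R by rewrite ler_peMr // (le_trans _ (ltW mu1)).
by rewrite -e leNgt mu1.
Qed.

Lemma len_ge0 A a b : SL2_frieze n A -> 0 <= len A a b.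
Proof.
move=> hA; have [->|ab] := eqVneq a b; first by rewrite lenxx.
exact/ltW/len_gt0.
Qed.

Let len1_out a b : a \notin S -> b \notin S -> len A1 a b <> 1.
Proof. by move=> aS bS; apply: scaled_neq1 (len_out aS bS); apply: len_ge0 c2.1. Qed.

Let len2_in a b : a \in S -> b \in S -> len A2 a b <> 1.
Proof. by move=> aS bS; apply: scaled_neq1 (len_in aS bS); apply: len_ge0 c1.1. Qed.

Let ear1 : eared T1 D S.
Proof. exact: common_eared t1 t2 c1 c2 altS len_opp len1_out len2_in. Qed.

Let ear2 : eared T2 D (~: S).
Proof.
(* The same argument with the two friezes exchanged and [S] replaced by its complement. *)
rewrite setIC; apply: common_eared t2 t1 c2 c1 _ _ _ _.
- exact: alternatingC.
- by move=> a b; rewrite !in_setC negbK => h; rewrite len_opp // -h negbK.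
- by move=> a b; rewrite !in_setC !negbK; apply: len2_in.
- by move=> a b; rewrite !in_setC; apply: len1_out.
Qed.

Let side P p q : P \in pieces D -> consec P p q -> (q \in S) = (p \notin S).
Proof. exact: common_side t1 t2 c1 c2 altS len1_out len2_in P p q. Qed.

(** Number the vertices of [P] clockwise from one outside [S]. The lengths from this vertex satisfy
    a three-term recurrence whose coefficients are the lengths of the chords cutting off one vertex:
    1 for a vertex outside [S], [mu] for one in [S]. *)
Lemma rescaled_card P : P \in pieces D ->
  (mu = 2 /\ #|P| = 4%N) \/ (mu = 3 /\ #|P| = 6%N).
Proof.
move=> pP; have cP := piece_card2 pP.
have [o oP oS] : exists2 o, o \in P & o \notin S.
  have [u uP _] := third_vertex ord0 ord0 cP.
  have [uS|uS] := boolP (u \in S); last by exists u.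
  have h := next_inP uP (ltnW cP); have /consecP[_ nP _ _] := h.
  by exists (next_in P u) => //; rewrite (side pP h) uS.
have [f [f0 fm fP fS mono]] := piece_enum oP.
have fc j : (j < #|P|)%N -> consec P (f j) (f j.+1).
  by apply: enum_consec f0 fm fP fS mono; apply: ltnW.
have fodd j : (j <= #|P|)%N -> (f j \in S) = odd j.
  elim: j => [|j IH] hj; first by rewrite f0 (negPf oS).
  by rewrite (side pP (fc j hj)) IH ?(ltnW hj).
have in1 p c q : consec P p c -> consec P c q -> c \notin S -> len A1 p q = 1.
  by move=> h1 h2 h3; apply: (len_link t1 c1); rewrite linkE (ear1 pP h1 h2 h3).
have in2 p c q : consec P p c -> consec P c q -> c \in S -> (len A1 p q)%:~R = mu.
  move=> h1 h2 h3; have := side pP h1; have := side pP h2; rewrite h3 => qS /esym pS.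
  rewrite len_out ?pS ?qS // (_ : len A2 p q = 1) ?mulr1 //.
  apply: (len_link t2 c2); rewrite linkE (ear2 pP h1 h2) //.
  by rewrite in_setC h3.
have lenf j : (j < #|P|)%N -> len A1 (f j) (f j.+1) = 1.
  move=> hj; apply: (len_link t1 c1); have /piecesP[_ hl _] := pP.
  exact: sub_link (subsetIl _ _) (hl _ _ (fc j hj)).
have cP1 := ltnW cP; have cP0 := ltnW cP1.
(* This chord cuts off [f 1], which is in [S], so its length is [mu]; in particular [mu] is an
   integer. *)
pose K := len A1 (f 0%N) (f 2).
have eK : K%:~R = mu by apply: (@in2 _ (f 1%N)); rewrite ?fc ?fodd // ltnW.
have K2 : 2 <= K.
  have : 1 < K by rewrite -(ltr_int R) eK.
  by lia.
have pos j : (0 < j < #|P|)%N -> 0 < len A1 (f 0%N) (f j).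
  move=> hj; apply: (len_gt0 c1.1); apply/eqP => e.
  by have := mono 0%N j hj; rewrite e ltnn.
have : (K = 2 /\ #|P| = 4%N) \/ (K = 3 /\ #|P| = 6%N).
  apply: (alternating_recurrence (x := fun j => len A1 (f 0%N) (f j))) => //.
  - by rewrite -fodd // fm.
  - by rewrite lenxx.
  - exact: lenf.
  - by rewrite fm f0 lenxx.
  move=> j hj; have hj' := ltnW hj.
  have [b1 b2] := consec2_between cP (fc j hj') (fc j.+1 hj).
  have nz : f 0%N != f j.+1.
    by apply/eqP => e; have := mono 0%N j.+1; rewrite hj e ltnn => /(_ isT).
  have e := three_term c1.1 b1 nz (b2 _ (fP 0%N cP0) nz) (lenf _ hj') (lenf _ hj).
  have h1 := in1 _ _ _ (fc j hj') (fc j.+1 hj); have h2 := in2 _ _ _ (fc j hj') (fc j.+1 hj).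
  rewrite fodd ?(ltnW hj) //= in h1 h2.
  have <- : len A1 (f j) (f j.+2) = if odd j then 1 else K.
    case: (odd j) h1 h2 => /= h1 h2; first exact: h1.
    by apply/eqP; rewrite -(eqr_int R) h2 // eK.
  by rewrite mulrC e; ring.
case=> -[eK' cK]; [left|right]; split=> //; by rewrite -eK eK'.
Qed.

Lemma rescaled_multiflip_data :
  exists m, (m = 4%N \/ m = 6%N) /\ multiflip_data m D S T1 T2.
Proof.
have dD : dissection D by apply: common_dissection.
have [P] : exists P, P \in [set P in pieces D | ord0 \in P].
  by apply/set0Pn; rewrite -card_gt0 triangles_nbrs.
move=> /setIdP[pP _]; exists #|P|.
split; first by case: (rescaled_card pP) => -[_ ->]; [left|right].
split=> //; try exact: subsetIl; try exact: subsetIr.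
(* All pieces have the same size because [mu] cannot be both 2 and 3. *)
move=> Q pQ; have := rescaled_card pP; have := rescaled_card pQ.
have n23 : (2 : R) <> 3 by move/eqP; rewrite eqr_nat.
by case=> -[-> ->] [[e ->]|[e ->]] //; case: n23.
Qed.

End Rescaled.
End Core.

(** * Multiflips *)

Section Multiflips.
Variable n : nat.
Notation V := 'I_n.+3.
Implicit Types (a b c o p q r s x y z v : V) (P Q H S t : {set V}).
Implicit Types D T : {set {set V}}.

(** If [a] is outside [S], the chord of [T] that cuts [a] off from [P] crosses every diagonal of [P]
    at [a]. *)
Lemma eared_diag T D S P a b : dissection T -> eared T D S -> P \in pieces D ->
  [set a; b] \in T -> [set a; b] \in diagonals P -> a \in S.
Proof.
move=> dT eT pP abT abP; apply: contraT => aS; exfalso; have cP := piece_card2 pP.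
move: (abP); rewrite mem_diagonals => /and5P[aP bP ab nab nba].
have ba : b != a by rewrite eq_sym.
have [q aq] := consec_next aP bP ba; have [p pa] := consec_prev aP bP ba.
have pqT := eT _ _ _ _ pP pa aq aS.
have [h1 h2] := consec2_between cP pa aq; have h3 := h2 _ bP ba.
have bq : b != q by apply: contraNneq nab => ->.
have bp : b != p by apply: contraNneq nba => ->.
have h4 : between q b p by cyc p.
exact: dissection_nc dT pqT abT h1 h4.
Qed.

Lemma fourth_vertex P p c q : (3 < #|P|)%N ->
  exists z, [/\ z \in P, z != p, z != c & z != q].
Proof.
move=> cP; have : ~~ (P \subset [set p; c; q]).
  apply/negP => /subset_leq_card; rewrite leqNgt => /negP[]; apply: leq_ltn_trans cP.
  by rewrite -setUA cardsU1 cards2; do 2?case: (_ \notin _); case: eqP.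
by case/subsetPn => z zP; rewrite !inE !negb_or -andbA => /and3P[? ? ?]; exists z.
Qed.

Lemma skip_diag P p c q : (3 < #|P|)%N -> consec P p c -> consec P c q ->
  [set p; q] \in diagonals P.
Proof.
move=> cP pc cq; have [h1 h2] := consec2_between (ltnW cP) pc cq.
have [z [zP zp zc zq]] := fourth_vertex p c q cP; have h3 := h2 z zP zc.
have /consecP[pP cM _ _] := pc; have /consecP[_ qP _ _] := cq.
by apply: (between_diag pP qP cM zP h1); cyc p.
Qed.

Lemma diag_of_refinement T D e : dissection T -> dissection D -> D \subset T ->
  e \in T -> e \notin D -> exists2 P, P \in pieces D & e \in diagonals P.
Proof.
move=> dT dD sDT eT; have [a [b e2]] := dissection_pair dT eT; move: eT; rewrite e2 => abT abD.
have /and3P[ab b1 a1] := dissection_neq dT abT.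
apply: diag_in_piece => //; last by rewrite linkE !negb_or abD b1.
have nT : noncross T a b by apply: dissection_noncross; rewrite // linkE abT.
by move=> r s /(subsetP sDT); apply: nT.
Qed.

Lemma set3_sides t a b : #|t| = 3%N -> a \in t -> b \in t -> a != b ->
  [set a; b] \in sides t.
Proof.
move=> ct at_ bt ab; rewrite mem_sides; apply: contraT; rewrite negb_or => /andP[h1 h2].
have := mem_diagonals t a b; rewrite at_ bt ab h1 h2 => /diag_between[[x xt hx] [y yt hy]].
have u : uniq [:: a; b; x; y].
  have /and3P[_ xa xb] := between_neq hx; have /and3P[_ yb ya] := between_neq hy.
  have xy : x != y by cyc a.
  by rewrite /= !inE !negb_or ab (eq_sym a) xa (eq_sym a) ya (eq_sym b) xb (eq_sym b) yb xy.
have : (#|[:: a; b; x; y]| <= #|t|)%N.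
  by apply/subset_leq_card/subsetP => z; rewrite !inE => /or4P[]/eqP->.
by rewrite (card_uniqP u) ct.
Qed.

Definition skip P a b c := (consec P a c /\ consec P c b) \/ (consec P b c /\ consec P c a).

(** The triangle takes every second vertex starting from [o]. It is the only internal one at [o],
    since an internal triangle contains no two neighbours of the hexagon. *)
Lemma hexagon_triangle H o : #|H| = 6%N -> o \in H -> exists t,
  [/\ t \in internal_triangles H, o \in t,
      forall a b, a \in t -> b \in t -> a != b -> exists c, skip H a b c,
      forall x, x \in H -> x \notin t -> exists2 y, y \in t & consec H y x
    & forall t', t' \in internal_triangles H -> o \in t' -> t' = t].
Proof.
move=> cH oH; have [f [f0 fm fP fS mono]] := piece_enum oH.
have fc j : (j < 6)%N -> consec H (f j) (f j.+1).
  by rewrite -cH => hj; apply: (enum_consec (o := o)) => //; rewrite cH.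
rewrite cH in fm fP fS mono.
have fne i j : (i < j < 6)%N -> f i != f j.
  by move=> /mono h; apply: contraTneq h => ->; rewrite ltnn.
pose t : {set V} := [set f 0%N; f 2; f 4].
have inS (Q : V -> Prop) : Q (f 0%N) -> Q (f 2) -> Q (f 4) -> forall x, x \in t -> Q x.
  by move=> q0 q2 q4 x; rewrite !inE -orbA => /or3P[]/eqP->.
have ct : #|t| = 3%N.
  by rewrite /t -setUA cardsU1 cards2 !inE negb_or !fne.
have sk a b : a \in t -> b \in t -> a != b -> exists c, skip H a b c.
  move=> ha hb; move: a ha; apply: (inS); move: b hb; apply: (inS); rewrite ?eqxx // => _.
  - by exists (f 1%N); left; split; apply: fc.
  - by exists (f 5); right; split; [apply: fc | rewrite -fm in f0 *; rewrite f0; apply: fc].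
  - by exists (f 1%N); right; split; apply: fc.
  - by exists (f 3); left; split; apply: fc.
  - by exists (f 5); left; split; [apply: fc | rewrite -fm in f0 *; rewrite f0; apply: fc].
  - by exists (f 3); right; split; apply: fc.
have f0t : f 0%N \in t by rewrite !inE eqxx.
exists t; split=> //.
- rewrite inE ct eqxx; apply/and3P; split=> //.
    by apply/subsetP => x; move: x; apply: (inS); apply: fP.
  apply/subsetP => e /sidesP[a [b [/consecP[ha hb ab _] ->]]].
  have [c [[h1 h2]|[h1 h2]]] := sk a b ha hb ab; last rewrite setUC;
    by apply: skip_diag h1 h2; rewrite cH.
- by rewrite -f0.
- move=> x /fS[[|[|[|[|[|[|i]]]]]] // _ ->]; rewrite /t ?inE ?eqxx ?orbT // => _.
  + by exists (f 0%N); [rewrite !inE eqxx | apply: fc].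
  + by exists (f 2); [rewrite !inE eqxx orbT | apply: fc].
  + by exists (f 4); [rewrite !inE eqxx orbT | apply: fc].
move=> t'; rewrite inE => /and3P[/subsetP sH /eqP ct' /subsetP sd] ot'.
have nc a b : a \in t' -> b \in t' -> ~~ consec H a b.
  move=> ha hb; apply/negP => hc; have /consecP[_ _ ab _] := hc.
  have := sd _ (set3_sides ct' ha hb ab).
  by rewrite mem_diagonals hc /= !andbF.
rewrite -f0 in ot'.
have n1 : f 1%N \notin t' by apply/negP => h; have := nc _ _ ot' h; rewrite fc.
have n5 : f 5 \notin t'.
  by apply/negP => h; have := nc _ _ h ot'; rewrite f0 -fm fc.
(* Together with its opposite vertex [f 0], the vertex [f 3] would rule out all the others. *)
have n3 : f 3 \notin t'.
  apply/negP => h3.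
  have n2 : f 2 \notin t' by apply/negP => h; have := nc _ _ h h3; rewrite fc.
  have n4 : f 4 \notin t' by apply/negP => h; have := nc _ _ h3 h; rewrite fc.
  have : (#|t'| <= #|[set f 0%N; f 3]|)%N.
    apply/subset_leq_card/subsetP => x xt; have [i iP e] := fS _ (sH _ xt).
    case: i iP e xt => [|[|[|[|[|[|i]]]]]] // _ -> xt; rewrite ?inE ?eqxx ?orbT //.
    - by rewrite xt in n1.
    - by rewrite xt in n2.
    - by rewrite xt in n4.
    - by rewrite xt in n5.
  by rewrite ct' cards2; case: eqP.
apply/eqP; rewrite eqEcard ct ct' leqnn andbT.
apply/subsetP => x xt; have [i iP e] := fS _ (sH _ xt).
case: i iP e xt => [|[|[|[|[|[|i]]]]]] // _ -> xt; rewrite /t ?inE ?eqxx ?orbT //.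
- by rewrite xt in n1.
- by rewrite xt in n3.
- by rewrite xt in n5.
Qed.

Lemma quad_skip H o b : #|H| = 4%N -> [set o; b] \in diagonals H ->
  exists2 c, consec H o c & consec H c b.
Proof.
move=> cH; rewrite mem_diagonals => /and5P[oH bH ob n1 n2].
have [f [f0 fm fP fS mono]] := piece_enum oH.
have fc j : (j < 4)%N -> consec H (f j) (f j.+1).
  by rewrite -cH => hj; apply: (enum_consec (o := o)) => //; rewrite cH.
have [i iP e] := fS _ bH; rewrite cH in iP fm.
case: i iP e => [|[|[|[|i]]]] // _ e.
- by rewrite e f0 eqxx in ob.
- by rewrite e -f0 fc in n1.
- by exists (f 1%N); rewrite ?e -?f0 fc.
- by rewrite e -fm fc in n2.
Qed.

End Multiflips.

(** * From the common form to a multiflip *)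

Section FromData.
Variables (n m : nat).
Notation V := 'I_n.+3.
Variables (D T T' : {set {set V}}) (S : {set V}).
Hypotheses (dT : dissection T) (dT' : dissection T').
Hypothesis md : multiflip_data m D S T T'.
Implicit Types (a b c o p q r s x y z v : V) (P Q H t : {set V}).

Let dD := md_diss md.

Lemma data_diag P e v : P \in pieces D -> e \in diagonals P -> e \in T -> v \in e -> v \in S.
Proof.
move=> pP eP; have [a [b [e2 _ _ _]]] := diagonals_pair eP; move: eP; rewrite e2 => eP eT.
rewrite !inE => /orP[]/eqP->; first exact: eared_diag dT (md_ear md) pP eT eP.
by rewrite setUC in eP eT; apply: eared_diag dT (md_ear md) pP eT eP.
Qed.

Lemma data_diag' P e v : P \in pieces D -> e \in diagonals P -> e \in T' -> v \in e ->
  v \notin S.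
Proof.
move=> pP eP; have [a [b [e2 _ _ _]]] := diagonals_pair eP; move: eP; rewrite e2 => eP eT.
rewrite !inE -in_setC => /orP[]/eqP->; first exact: eared_diag dT' (md_ear' md) pP eT eP.
by rewrite setUC in eP eT; apply: eared_diag dT' (md_ear' md) pP eT eP.
Qed.

Lemma data_skip P p c q : P \in pieces D -> consec P p c -> consec P c q ->
  if c \in S then [set p; q] \in T' else [set p; q] \in T.
Proof.
move=> pP pc cq; case: ifP => cS.
  by apply: (md_ear' md) pP pc cq _; rewrite in_setC cS.
by apply: (md_ear md) pP pc cq _; rewrite cS.
Qed.

Lemma diag_nonempty P e : e \in diagonals P -> exists v, v \in e.
Proof. by case/diagonals_pair=> a [b [-> _ _ _]]; exists a; rewrite set21. Qed.

Lemma data_diagT P e : P \in pieces D -> e \in diagonals P -> e \in T' -> e \notin T.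
Proof.
move=> pP eP eT'; apply/negP => eT; have [v ve] := diag_nonempty eP.
by have := data_diag' pP eP eT' ve; rewrite (data_diag pP eP eT ve).
Qed.

Lemma some_piece v : exists2 P, P \in pieces D & v \in P.
Proof.
have [P /setIdP[pP vP]] : exists P, P \in [set P in pieces D | v \in P].
  by apply/set0Pn; rewrite -card_gt0 triangles_nbrs.
by exists P.
Qed.

Lemma piece_nbrs P v : P \in pieces D -> v \in P -> exists p q,
  consec P p v /\ consec P v q.
Proof.
move=> pP vP; have [x xP xv] := card_gt1_neq v (ltnW (piece_card2 pP)).
by have [p hp] := consec_prev vP xP xv; have [q hq] := consec_next vP xP xv; exists p, q.
Qed.

(** Each vertex [v] of [S] is incident: its successor in a piece is outside [S], and the chord of
    [T] that cuts this successor off starts at [v]. It is a diagonal of the piece because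
    [m > 3]. *)
Lemma data_incident : (3 < m)%N -> incident T D = S.
Proof.
move=> m4; apply/setP => v; apply/bigcupP/idP => [[P pP /bigcupP[e /setIP[eP eT] ve]]|vS].
  exact: data_diag pP eP eT ve.
have [P pP vP] := some_piece v; exists P => //.
have [_ [c [_ vc]]] := piece_nbrs pP vP.
have /consecP[_ cP _ _] := vc.
have [_ [q [_ cq]]] := piece_nbrs pP cP.
have cS : c \notin S by rewrite (md_side md pP vc) vS.
apply/bigcupP; exists [set v; q]; last exact: set21.
rewrite inE (md_ear md pP vc cq cS) andbT.
by apply: skip_diag vc cq; rewrite (md_card md pP).
Qed.

Lemma data_two : m = 4%N -> two_multiflip T T'.
Proof.
move=> m4; exists D.
  apply/and3P; split; first exact: md_sub md.
    by apply/andP; split; [apply: dD|apply/forall_inP => P /(md_card md)->; rewrite m4].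
  by rewrite data_incident ?m4 //; apply: md_alt md.
apply/setP => e; rewrite inE; apply/idP/orP => [eT'|[]].
- have [eD|eD] := boolP (e \in D); [by left|right].
  have [P pP eP] := diag_of_refinement dT' dD (md_sub' md) eT' eD.
  by apply/bigcupP; exists P; rewrite // inE eP andbT; apply: data_diagT eP eT'.
- by apply/subsetP; apply: md_sub' md.
case/bigcupP=> P pP /setDP[eP eT].
have [a [b [e2 aP bP ab]]] := diagonals_pair eP; rewrite e2 in eP eT *.
have cP : #|P| = 4%N by rewrite (md_card md pP).
have [c ac cb] := quad_skip cP eP.
by have := data_skip pP ac cb; case: ifP => // _; rewrite (negPf eT).
Qed.

Lemma skip_mem P a b c : P \in pieces D -> skip P a b c ->
  [/\ (a \in S) = (c \notin S), (b \in S) = (c \notin S) &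
      [set a; b] \in if c \in S then T' else T].
Proof.
move=> pP [[h1 h2]|[h1 h2]]; have h := data_skip pP h1 h2;
  have e1 := md_side md pP h1; have e2 := md_side md pP h2.
  by rewrite {1}e1 negbK e2; split=> //; case: ifP h.
by rewrite {2}e1 negbK e2 setUC; split=> //; case: ifP h.
Qed.

Lemma data_three : m = 6%N -> three_multiflip T T'.
Proof.
move=> m6; exists D.
  apply/and4P; split; first exact: md_sub md.
  - by apply/andP; split; [apply: dD|apply/forall_inP => P /(md_card md)->; rewrite m6].
  - apply/forall_inP => H pH; have cH : #|H| = 6%N by rewrite (md_card md pH).
    have [o oH oS] : exists2 o, o \in H & o \in S.
      have [u uH _] := third_vertex ord0 ord0 (piece_card2 pH).
      have [uS|uS] := boolP (u \in S); first by exists u.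
      have [_ [q [_ uq]]] := piece_nbrs pH uH; have /consecP[_ qH _ _] := uq.
      by exists q; rewrite // (md_side md pH uq) uS.
    (* Started in [S], this triangle stays in [S], since two steps along the hexagon preserve the
       class; its sides cut off vertices outside [S]. *)
    have [t [tI ot sk _ _]] := hexagon_triangle cH oH.
    have tS x : x \in t -> x \in S.
      have [->//|xo] := eqVneq x o; move=> xt.
      by have [c hc] := sk x o xt ot xo; have [-> <- _] := skip_mem pH hc.
    apply/exists_inP; exists t => //.
    apply/subsetP => e /sidesP[a [b [/consecP[ha hb ab _] ->]]].
    have [c hc] := sk a b ha hb ab; have [h _] := skip_mem pH hc.
    by move: h; rewrite (tS a ha) => /esym/negPf ->.
  - by rewrite data_incident ?m6 //; apply: md_alt md.
apply/setP => e; rewrite inE; apply/idP/orP => [eT'|[]].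
- have [eD|eD] := boolP (e \in D); [by left|right].
  have [H pH eH] := diag_of_refinement dT' dD (md_sub' md) eT' eD.
  have cH : #|H| = 6%N by rewrite (md_card md pH).
  have eT := data_diagT pH eH eT'.
  have [a [b [e2 aH bH ab]]] := diagonals_pair eH.
  have aS : a \notin S by apply: data_diag' pH eH eT' _; rewrite e2 set21.
  have bS : b \notin S by apply: data_diag' pH eH eT' _; rewrite e2 set22.
  have [t [tI ot sk nt _]] := hexagon_triangle cH aH.
  have tS x : x \in t -> x \notin S.
    have [->//|xa] := eqVneq x a; move=> xt.
    by have [c hc] := sk x a xt ot xa; have [-> <- _] := skip_mem pH hc.
  have bt : b \in t.
    apply: contraNT bS => /(nt _ bH)[y yt yb].
    by rewrite (md_side md pH yb) tS.
  have est : e \in sides t.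
    rewrite e2; apply: set3_sides => //.
    by move: tI; rewrite inE => /and3P[_ /eqP].
  apply/bigcupP; exists H => //; apply/bigcupP; exists t => //.
  by rewrite tI /=; apply: contraNN eT => /subsetP; apply.
- by apply/subsetP; apply: md_sub' md.
case/bigcupP=> H pH /bigcupP[t /andP[tI nsT] /sidesP[a [b [/consecP[ha hb ab _] ->]]]].
have cH : #|H| = 6%N by rewrite (md_card md pH).
have aH : a \in H by move: tI; rewrite inE => /and3P[/subsetP/(_ a ha)].
have [t' [_ at' sk _ /(_ t tI ha) et]] := hexagon_triangle cH aH; subst t'.
(* Otherwise all of [t] would lie in [S], and its sides would be in [T]. *)
have aS : a \notin S.
  apply: contraNN nsT => aS; apply/subsetP => _ /sidesP[x [y [/consecP[hx hy xy _] ->]]].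
  have [c hc] := sk x y hx hy xy; have [h1 _] := skip_mem pH hc.
  suff xS : x \in S by move: h1; rewrite xS => /esym/negPf ->.
  have [->//|xa] := eqVneq x a.
  by have [c' hc'] := sk x a hx ha xa; have [-> <- _] := skip_mem pH hc'.
have [c hc] := sk a b ha hb ab; have [h1 _] := skip_mem pH hc.
by move: h1; rewrite (negPf aS) => /esym/negbFE ->.
Qed.

(** The diagonals of [T] inside [P] join vertices of [S] two steps apart: at a vertex of [S] there
    is one in a quadrilateral and there are two in a hexagon. *)
Lemma data_card_nbrs P v : P \in pieces D -> v \in P -> m = 4%N \/ m = 6%N ->
  #|[set x | ([set v; x] \in T) && ([set v; x] \in diagonals P)]| =
    if v \in S then m./2.-1 else 0%N.
Proof.
move=> pP vP hm; have cP := md_card md pP; case: ifPn => vS; last first.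
  apply/eqP; rewrite cards_eq0; apply/eqP/setP => x; rewrite in_set in_set0; apply/negP.
  by case/andP=> h1 h2; case/negP: vS; apply: data_diag pP h2 h1 (set21 _ _).
have [f [f0 fm fP fS mono]] := piece_enum vP; rewrite cP in fm fP fS mono.
have fc j : (j < m)%N -> consec P (f j) (f j.+1).
  have m1 : (1 < m)%N by case: hm => ->.
  by move=> hj; apply: (enum_consec (o := v)); rewrite ?cP.
have fodd j : (j <= m)%N -> (f j \in S) = ~~ odd j.
  elim: j => [|j IH] hj; first by rewrite f0 vS.
  by rewrite (md_side md pP (fc j hj)) IH ?(ltnW hj).
have sk j : (j.+1 < m)%N -> ~~ odd j -> [set f j; f j.+2] \in T.
  move=> hj oj; have := data_skip pP (fc j (ltnW hj)) (fc j.+1 hj).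
  by rewrite fodd ?(ltnW hj) //= oj.
have inN x : x \in P -> ([set v; x] \in T) && ([set v; x] \in diagonals P) -> x \in S.
  by move=> xP /andP[h1 h2]; apply: data_diag pP h2 h1 (set22 _ _).
have mem x : ([set v; x] \in T) && ([set v; x] \in diagonals P) ->
    exists2 j, (0 < j < m)%N && ~~ odd j & x = f j.
  move=> h; have [hT hd] := andP h; have := hd.
  rewrite mem_diagonals => /and5P[_ xP vx _ _].
  have xS := inN x xP h; have [j jm e] := fS _ xP.
  exists j => //; rewrite -fodd ?(ltnW jm) // -e xS jm !andbT lt0n.
  by apply: contraNneq vx => j0; rewrite e j0 f0.
have m3 : (3 < #|P|)%N by rewrite cP; case: hm => ->.
case: hm => em.
  rewrite (_ : [set x | _] = [set f 2]) ?cards1 ?em //.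
  apply/setP => x; rewrite in_set in_set1; apply/idP/eqP => [/mem[j]|->].
    by rewrite em; case: j => [|[|[|[|j]]]].
  rewrite -f0 sk ?em //=; apply: (skip_diag m3 (fc 0%N _) (fc 1%N _)); by rewrite em.
rewrite (_ : [set x | _] = [set f 2; f 4]) ?cards2 ?em /=.
  suff -> : f 2 != f 4 by [].
  by have := mono 2%N 4%N; rewrite em => /(_ isT) h; apply: contraTneq h => ->; rewrite ltnn.
apply/setP => x; rewrite in_set in_set2; apply/idP/orP => [/mem[j]|[]/eqP->].
- by rewrite em; case: j => [|[|[|[|[|[|j]]]]]] // _ ->; [left|right].
- rewrite -f0 sk ?em //=; apply: (skip_diag m3 (fc 0%N _) (fc 1%N _)); by rewrite em.
- rewrite setUC -fm em sk ?em //=; apply: (skip_diag m3 (fc 4%N _) (fc 5 _)); by rewrite em.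
Qed.

End FromData.

(** * From a multiflip to the common form *)

Section ToData.
Variable n : nat.
Notation V := 'I_n.+3.
Implicit Types (a b c o p q r s x y z v : V) (P Q H S t : {set V}).
Implicit Types D T : {set {set V}}.

Lemma multiflip_dataC m D S T T' :
  multiflip_data m D S T T' -> multiflip_data m D (~: S) T' T.
Proof.
case=> h1 h2 h3 h4 h5 h6 h7 h8; split=> //.
- exact: alternatingC.
- by move=> P p q pP pq; rewrite !in_setC (h6 P p q pP pq).
- by rewrite setCK.
Qed.

(** A diagonal of [T] at [v] outside [D] lies in exactly one piece of [D], and there are
    [#|nbrs D v|.+1] pieces at [v], each contributing [w]. *)
Lemma card_nbrs_refine D T v w : dissection D -> dissection T -> D \subset T ->
  (forall P, P \in pieces D -> v \in P ->
     #|[set x | ([set v; x] \in T) && ([set v; x] \in diagonals P)]| = w) ->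
  #|nbrs T v|.+1 = (#|nbrs D v|.+1 * w.+1)%N.
Proof.
move=> dD dT sDT hw; pose F P := [set x | [&& P \in pieces D, v \in P, [set v; x] \in T
  & [set v; x] \in diagonals P]].
have inF P x : (x \in F P) = [&& P \in pieces D, v \in P, [set v; x] \in T
    & [set v; x] \in diagonals P] by rewrite in_set.
have disjF P Q : P != Q -> [disjoint F P & F Q].
  move=> nPQ; apply/pred0P => x /=; apply/negP; rewrite !inF.
  case/andP=> /and4P[pP _ _ hP] /and4P[pQ _ _ hQ].
  by case/eqP: nPQ; apply: diag_piece_uniq dD pP pQ hP hQ.
have e : nbrs T v :\: nbrs D v = \bigcup_P F P.
  apply/setP => x; rewrite inE !in_nbrs; apply/idP/bigcupP => [/andP[nD hT]|[P _]].
    have [P pP hP] := diag_of_refinement dT dD sDT hT nD.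
    by exists P; rewrite // inF pP hT hP; move: hP; rewrite mem_diagonals => /andP[->].
  rewrite inF => /and4P[pP vP -> hP]; rewrite andbT; apply/negP => xD.
  by have /piecesP[_ _ /(_ _ _ xD)] := pP; rewrite hP.
have sub : nbrs D v \subset nbrs T v.
  by apply/subsetP => x; rewrite !in_nbrs; apply: (subsetP sDT).
have := cardsID (nbrs D v) (nbrs T v); rewrite (setIidPr sub) e => <-.
have -> : #|\bigcup_P F P| = (\sum_P #|F P|)%N.
  rewrite -sum1_card (partition_disjoint_bigcup _ _ disjF).
  by apply: eq_bigr => P _; rewrite sum1_card.
rewrite (bigID (fun P => P \in [set P in pieces D | v \in P])) /= [X in (_ + (_ + X))%N]big1 ?addn0.
  rewrite (eq_bigr (fun=> w)) => [|P]; first by rewrite sum_nat_const triangles_nbrs // mulnS addSn.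
  case/setIdP=> pP vP; rewrite -(hw P pP vP); apply: eq_card => x.
  by rewrite inF in_set pP vP.
move=> P hP; apply: eq_card0 => x; rewrite inF; apply: contraNF hP.
by case/and4P=> pP vP _ _; apply/setIdP.
Qed.

Lemma data_nbrs m D S T T' v : multiflip_data m D S T T' -> dissection T ->
  m = 4%N \/ m = 6%N ->
  #|nbrs T v|.+1 = (#|nbrs D v|.+1 * if v \in S then m./2 else 1)%N.
Proof.
move=> md dT hm.
rewrite (card_nbrs_refine (md_diss md) dT (md_sub md) (w := if v \in S then m./2.-1 else 0%N)).
  by case: hm => ->; case: ifP.
by move=> P pP vP; apply: data_card_nbrs dT md _ _ pP vP hm.
Qed.

Lemma pos_sub o x y : (pos o x <= pos o y)%N -> pos x y = (pos o y - pos o x)%N.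
Proof.
rewrite /pos !val_subE; have := (ltn_ord o, ltn_ord x, ltn_ord y) => -[[]].
by do 3?[case: ifP]; lia.
Qed.

(** By induction on the clockwise distance from [a] to [b]: in the piece on this arc the other sides
    are shorter, so membership in [S] alternates along them, and their number is odd. *)
Lemma even_pieces_link D S a b : dissection D -> alternating S ->
  (forall P, P \in pieces D -> ~~ odd #|P|) -> link D a b -> (b \in S) = (a \notin S).
Proof.
move=> dD /alternatingP altS ev; have [k hk] := ubnP (pos a b).
elim: k a b hk => // k IH a b hk lab.
have [->|ne] := eqVneq b (a + 1); first exact: altS.
have [P [pP aP bP [x xP hx] hb]] := piece_on_link dD lab ne.
have cP := piece_card2 pP.
have [f [f0 fm fP fS mono]] := piece_enum aP.
have fc j : (j < #|P|)%N -> consec P (f j) (f j.+1).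
  exact: enum_consec (ltnW cP) f0 fm fP fS mono.
have ba : consec P b a.
  by apply/consecP; split=> //; have /and3P[] := between_neq hx; rewrite eq_sym.
have cm : (#|P|.-1.+1 = #|P|)%N by rewrite prednK // (ltn_trans _ cP).
have cm1 : (#|P|.-1 < #|P|)%N by rewrite cm.
have fb : f #|P|.-1 = b.
  by have := fc _ cm1; rewrite cm fm => h; apply: consec_prev_uniq h ba.
have /piecesP[_ hl _] := pP.
have fodd j : (j < #|P|)%N -> (f j \in S) = (a \in S) (+) odd j.
  elim: j => [|j IHj] hj; first by rewrite f0 addbF.
  have hj' := ltnW hj.
  rewrite (IH (f j)) ?IHj // /=; first by rewrite -addbT -addbA addbT.
    have h1 : (pos a (f j) < pos a (f j.+1))%N by apply: mono; rewrite ltnSn.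
    rewrite (pos_sub (o := a)) ?(ltnW h1) //.
    have h2 : (pos a (f j.+1) <= pos a b)%N.
      rewrite -fb; have [->//|nj] := eqVneq j.+1 #|P|.-1.
      by apply/ltnW/mono; rewrite cm1 andbT; move: nj hj cm; clear; lia.
    (* The first side starts at [a] itself, and is shorter than [ab] because [P] has a third
       vertex. *)
    case: j {IHj hj'} hj h1 h2 => [|j] hj h1 h2.
      have : (pos a (f 1%N) < pos a b)%N.
        by rewrite -fb; apply: mono; rewrite cm1 andbT; move: cP; clear; lia.
      by move: hk; clear; lia.
    have h3 : (pos a (f 0%N) < pos a (f j.+1))%N by apply: mono; apply: ltnW.
    by move: hk h1 h2 h3; clear; lia.
  exact: hl (fc j hj').
rewrite -fb fodd // (_ : odd #|P|.-1) ?addbT //.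
by have := ev P pP; rewrite -{1}cm /= negbK.
Qed.

(** For [c] outside the incident set, the triangle of [T] on [pc] must have [q] as its apex: any
    other apex would give a diagonal of [P] in [T] at [c]. *)
Lemma data_from_incident m D T T' : triangulation T -> D \subset T -> D \subset T' ->
  partition_into m D -> (3 < m)%N -> ~~ odd m -> alternating (incident T D) ->
  eared T' D (~: incident T D) -> multiflip_data m D (incident T D) T T'.
Proof.
move=> tT sT sT' /andP[dD /forall_inP hc] m3 em altS ear'; have dT := triangulation_dissection tT.
have cP P : P \in pieces D -> #|P| = m by move/hc/eqP.
have hl a b : link D a b -> (b \in incident T D) = (a \notin incident T D).
  by apply: even_pieces_link => // P /cP->.
have side P p q : P \in pieces D -> consec P p q ->
    (q \in incident T D) = (p \notin incident T D).
  by move=> pP pq; apply: hl; have /piecesP[_ h _] := pP; apply: h.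
split=> // P p c q pP pc cq cS.
have [x [xP hx cx xp]] := apex tT dD sT pP pc.
have /and3P[_ xc xp'] := between_neq hx.
have /consecP[pM cM _ _] := pc.
have inc a b v : [set a; b] \in T -> [set a; b] \in diagonals P -> v \in [set a; b] ->
    v \in incident T D.
  move=> h1 h2 h3; apply/bigcupP; exists P => //; apply/bigcupP; exists [set a; b] => //.
  by rewrite inE h1 h2.
have xq : x = q.
  apply/eqP; apply: contraNT cS => xq.
  have ncx : ~~ consec P c x by apply: contraNN xq => h; rewrite (consec_next_uniq cq h).
  have nxc : ~~ consec P x c by apply: contraNN xp' => h; rewrite (consec_prev_uniq pc h).
  have hd : [set c; x] \in diagonals P by rewrite mem_diagonals cM xP eq_sym xc ncx.
  have [[y yP hy] [z zP hz]] := diag_between hd.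
  exact: inc (link_between cx hy hz) hd (set21 _ _).
rewrite xq in xp; have hd : [set p; q] \in diagonals P by apply: skip_diag pc cq; rewrite cP.
have [[y yP hy] [z zP hz]] := diag_between hd.
by apply: link_between hy hz; rewrite linkC.
Qed.

Lemma incident_diag D T P a b : P \in pieces D -> [set a; b] \in diagonals P ->
  a \notin incident T D -> [set a; b] \notin T.
Proof.
move=> pP hd; apply: contraNN => hT; apply/bigcupP; exists P => //.
by apply/bigcupP; exists [set a; b]; rewrite ?in_setI ?hT ?hd ?set21.
Qed.

Lemma two_multiflip_data T T' : triangulation T -> two_multiflip T T' ->
  exists D, multiflip_data 4 D (incident T D) T T'.
Proof.
move=> tT [D /and3P[sD pD altS] eT']; exists D.
have sD' : D \subset T' by rewrite eT' subsetUl.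
apply: data_from_incident => // P p c q pP pc cq; rewrite in_setC negbK => cS.
have /andP[dD /forall_inP hc] := pD; have cP := eqP (hc _ pP).
have hd : [set p; q] \in diagonals P by apply: skip_diag pc cq; rewrite cP.
have ev P' : P' \in pieces D -> ~~ odd #|P'| by move/hc/eqP->.
have pS : p \notin incident T D.
  have /piecesP[_ /(_ _ _ pc) l _] := pP.
  by rewrite -(even_pieces_link dD altS ev l).
rewrite eT' inE; apply/orP; right; apply/bigcupP; exists P => //.
by rewrite inE hd andbT; apply: incident_diag hd pS.
Qed.

Lemma three_multiflip_data T T' : triangulation T -> three_multiflip T T' ->
  exists D, multiflip_data 6 D (incident T D) T T'.
Proof.
move=> tT [D /and4P[sD pD _ altS] eT']; exists D.
have sD' : D \subset T' by rewrite eT' subsetUl.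
apply: data_from_incident => // P p c q pP pc cq; rewrite in_setC negbK => cS.
have /andP[dD /forall_inP hc] := pD; have cP := eqP (hc _ pP).
have hd : [set p; q] \in diagonals P by apply: skip_diag pc cq; rewrite cP.
have ev P' : P' \in pieces D -> ~~ odd #|P'| by move/hc/eqP->.
have hl x y : consec P x y -> (y \in incident T D) = (x \notin incident T D).
  move=> xy; have /piecesP[_ /(_ _ _ xy) l _] := pP.
  exact: even_pieces_link dD altS ev l.
have pS : p \notin incident T D by rewrite -(hl _ _ pc).
have qS : q \notin incident T D by rewrite (hl _ _ cq) cS.
have /consecP[pM _ _ _] := pc; have /consecP[_ qM _ _] := cq.
(* This triangle avoids the incident vertices and contains [q]. Its side [pq] is not in [T], so the
   multiflip adds its sides to [T']. *)
have [t [tI pt sk nt _]] := hexagon_triangle cP pM.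
have tS x : x \in t -> x \notin incident T D.
  have [->//|xp] := eqVneq x p; move=> xt.
  by have [y [[/hl h1 /hl h2]|[/hl h1 /hl h2]]] := sk x p xt pt xp;
    move: pS; rewrite ?h2 ?h1 ?negbK // -h1 ?negbK h2.
have qt : q \in t.
  by apply: contraNT qS => /(nt _ qM)[y /tS yS /hl ->].
have pq : [set p; q] \in sides t.
  apply: set3_sides pt qt _; last by move: hd; rewrite mem_diagonals => /and5P[].
  by move: tI; rewrite inE => /and3P[_ /eqP].
rewrite eT' inE; apply/orP; right; apply/bigcupP; exists P => //.
apply/bigcupP; exists t => //; rewrite tI /=.
by apply: contraNN (incident_diag pP hd pS) => /subsetP; apply.
Qed.

End ToData.

(** * Rescaling of friezes *)

Lemma evenz_succ (i : int) : (2 %| i + 1)%Z = ~~ (2 %| i)%Z.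
Proof. lia. Qed.

Lemma signz (i : int) : ((-1 : int) ^ i) = if (2 %| i)%Z then 1 else -1.
Proof.
elim/int_rect: i => [|k IH|k IH]; first by rewrite expr0z.
  by rewrite intS addrC exprzDr // expr1z IH evenz_succ; case: ifP; rewrite ?mulN1r ?mul1r ?opprK.
have -> : (2 %| - k.+1%:Z)%Z = ~~ (2 %| - k%:Z)%Z by lia.
have -> : - k.+1%:Z = - k%:Z + (- 1) by lia.
by rewrite exprzDr // IH; case: (2 %| _)%Z.
Qed.

Lemma rescalingE (R : realType) (lam : R) A i j :
  rescaling lam A i j =
  if (2 %| i - j)%Z then (if (2 %| i)%Z then lam^-1 else lam) * (A i j)%:~R
  else (A i j)%:~R.
Proof.
rewrite /rescaling signz evenz_succ; case: ifP => // _.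
by case: (2 %| i)%Z => /=; rewrite ?expr1z // exprN1.
Qed.

(** By induction on [i - j]: in each of the two products of the unimodular rule the rescaling
    factors cancel, so the rescaled entries obey the same rule, which determines the next entry. *)
Lemma is_rescaling_quiddity (R : realType) n (lam : R) A A' : odd n -> lam != 0 ->
  SL2_frieze n A -> SL2_frieze n A' ->
  (forall i, (quiddity A' i)%:~R =
     (if (2 %| i)%Z then lam else lam^-1) * (quiddity A i)%:~R) ->
  is_rescaling n lam A A'.
Proof.
move=> on l0 [a1 _ a3 a4] [b1 _ b3 b4] hq; split=> // i j.
have main k : (k <= n.+1)%N -> forall j, (A' (j + k%:Z + 1) j)%:~R =
    rescaling lam A (j + k%:Z + 1) j.
  have [m hm] := ubnP k; elim: m k hm => // m IH [|[|k]] hk kn {}j.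
  - by rewrite addr0 rescalingE a1 b1 (_ : (2 %| j + 1 - j)%Z = false) //; lia.
  - have := hq (j + 1); rewrite /quiddity rescalingE.
    have -> : j + 1 - 1 = j by lia.
    rewrite (_ : (2 %| j + 1%:Z + 1 - j)%Z); last by lia.
    have -> : (2 %| j + 1%:Z + 1)%Z = ~~ (2 %| j + 1)%Z by lia.
    by case: (2 %| j + 1)%Z.
  have e1 := IH k.+1 (ltac:(lia)) (ltac:(lia)) j.
  have e2 := IH k.+1 (ltac:(lia)) (ltac:(lia)) (j + 1).
  have e3 := IH k (ltac:(lia)) (ltac:(lia)) (j + 1).
  pose i' := j + k.+1%:Z + 1.
  have ha := a4 i' j (ltac:(lia)); have hb := b4 i' j (ltac:(lia)).
  have ei : j + 1 + k.+1%:Z + 1 = i' + 1 by lia.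
  have ei' : j + 1 + k%:Z + 1 = i' by lia.
  have ei'' : j + k.+2%:Z + 1 = i' + 1 by lia.
  rewrite -/i' in e1; rewrite ei in e2; rewrite ei' in e3; rewrite ei''.
  have pos (B : int -> int -> int) : (forall i : int, B (i + 1) i = 1) ->
      (forall i j : int, 2 <= i - j <= n%:Z + 1 -> 0 < B i j) -> B i' (j + 1) != 0.
    move=> h1 h3; case: (posnP k) => [k0|k0].
      by rewrite (_ : i' = j + 1 + 1) ?h1 //; lia.
    by apply/lt0r_neq0/h3; lia.
  have pb : (A' i' (j + 1))%:~R != 0 :> R by rewrite intr_eq0 pos.
  have pa : (A i' (j + 1))%:~R != 0 :> R by rewrite intr_eq0 pos.
  have {}ha : (A i' j * A (i' + 1) (j + 1))%:~R =
    (1 + A i' (j + 1) * A (i' + 1) j)%:~R :> R by congr (_%:~R); lia.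
  have {}hb : (A' i' j * A' (i' + 1) (j + 1))%:~R =
    (1 + A' i' (j + 1) * A' (i' + 1) j)%:~R :> R by congr (_%:~R); lia.
  rewrite intrD !intrM mulr1z in ha; rewrite intrD !intrM mulr1z in hb.
  apply: (mulfI pb); apply: (addrI 1); rewrite -hb e1 e2 e3 !rescalingE.
  have -> : (2 %| i' + 1 - (j + 1))%Z = (2 %| i' - j)%Z by lia.
  have -> : (2 %| i' - (j + 1))%Z = ~~ (2 %| i' - j)%Z by lia.
  have -> : (2 %| i' + 1 - j)%Z = ~~ (2 %| i' - j)%Z by lia.
  rewrite (evenz_succ i'); case: (2 %| i' - j)%Z => /=.
    rewrite -ha; case: (2 %| i')%Z => /=; by field.
  rewrite ha; case: (2 %| i')%Z => /=; by field.
rewrite /in_strip => hs; have [k ek] : exists k : nat, i = j + k%:Z + 1.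
  by exists (absz (i - j - 1)%R); lia.
by rewrite ek main //; lia.
Qed.

Lemma is_rescaling_len (R : realType) n (lam : R) A A' (a b : 'I_n.+3) :
  is_rescaling n lam A A' ->
  (len A' a b)%:~R = (if odd a == odd b then (if odd b then lam else lam^-1) else 1)
    * (len A a b)%:~R.
Proof.
case=> _ h.
wlog ab : a b / (a <= b)%N => [H|].
  have /orP[|ba] := leq_total a b; first exact: H.
  by rewrite lenC (lenC A) (H _ _ ba) eq_sym; case: eqP => // ->.
have [|] := eqVneq (a : nat) b; first by move/val_inj->; rewrite !lenxx mulr0.
move=> ne; have lt : (a < b)%N by rewrite ltn_neqAle ne.
have hb := ltn_ord b; rewrite /len lt h; last by rewrite /in_strip; lia.
rewrite rescalingE (_ : (2 %| b%:Z - a%:Z)%Z = (odd a == odd b)); last by lia.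
by rewrite (_ : (2 %| b%:Z)%Z = ~~ odd b) ?if_neg; [case: ifP; rewrite ?mul1r | lia].
Qed.

Lemma alternating_odd n (b : bool) : odd n -> alternating [set v : 'I_n.+3 | odd v == b].
Proof.
move=> on; apply/alternatingP => v; rewrite !inE val_succE.
by case: ifP => [/eqP->|_] /=; rewrite ?on; case: b; case: (odd v).
Qed.

Lemma alternating_int n (S : {set 'I_n.+3}) (i : int) : alternating S ->
  ((i%:~R : 'I_n.+3) \in S) = ((0 : 'I_n.+3) \in S) (+) ~~ (2 %| i)%Z.
Proof.
move/alternatingP => h; have {h} step k :
    (((k + 1)%:~R : 'I_n.+3) \in S) = ((k%:~R : 'I_n.+3) \notin S).
  by rewrite intrD h.
elim/int_rect: i => [|k IH|k IH]; first by rewrite addbF.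
  by rewrite intS addrC step IH evenz_succ !addbN.
have := step (- k.+1%:Z); rewrite (_ : - k.+1%:Z + 1 = - k%:Z); last by lia.
rewrite IH (_ : (2 %| - k%:Z)%Z = ~~ (2 %| - k.+1%:Z)%Z); last by lia.
by rewrite addbN => /negb_inj ->.
Qed.

(** Going once around takes [n + 3] steps, each of which changes membership in [S]. *)
Lemma alternating_odd_order n (S : {set 'I_n.+3}) : alternating S -> odd n.
Proof.
move=> altS; have := alternating_int n.+3 altS.
have -> : (n.+3%:Z%:~R : 'I_n.+3) = 0.
  by apply: val_inj; rewrite -pmulrn Zp_nat /= modnn.
by case: (_ \in S) => /= /esym; lia.
Qed.

Lemma data_rescaling (R : realType) n m D S (T T' : {set {set 'I_n.+3}}) A A' :
  triangulation T -> triangulation T' -> corresponds T A -> corresponds T' A' ->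
  m = 4%N \/ m = 6%N -> multiflip_data m D S T T' ->
  exists lam : R, [/\ 0 < lam, lam != 1 & is_rescaling n lam A A'].
Proof.
move=> tT tT' [hA qA] [hA' qA'] hm md.
have altS := md_alt md; have on := alternating_odd_order altS.
pose h : R := (m./2)%:R.
have h1 : 1 < h by rewrite /h ltr1n; case: hm => ->.
have h0 : 0 < h by apply: lt_trans h1.
(* The number of triangles is divided by [h] at vertices of [S] and multiplied by [h] elsewhere,
   while a rescaling multiplies the quiddity at even indices by [lam]. *)
pose lam := if (0 : 'I_n.+3) \in S then h^-1 else h.
have lam0 : 0 < lam by rewrite /lam; case: ifP; rewrite ?invr_gt0.
exists lam; split=> //.
  by rewrite /lam; case: ifP => _; rewrite ?invr_eq1 gt_eqF.
apply: is_rescaling_quiddity on (lt0r_neq0 lam0) hA hA' _ => i.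
have dT := triangulation_dissection tT; have dT' := triangulation_dissection tT'.
rewrite qA qA' /triangles_at !triangles_nbrs // -!pmulrn.
rewrite (data_nbrs _ md dT hm) (data_nbrs _ (multiflip_dataC md) dT' hm) in_setC.
rewrite (alternating_int i altS) !natrM /lam.
have hn := lt0r_neq0 h0.
case: (_ \in S); case: (2 %| i)%Z => /=; rewrite -/h ?invrK; by field.
Qed.

Lemma multiflip_rescaling (R : realType) n (T T' : {set {set 'I_n.+3}}) A A' :
  triangulation T -> triangulation T' -> corresponds T A -> corresponds T' A' ->
  multiflip T T' -> exists lam : R, [/\ 0 < lam, lam != 1 & is_rescaling n lam A A'].
Proof.
move=> tT tT' cA cA' [h|h].
  have [D md] := two_multiflip_data tT h.
  by apply: data_rescaling cA cA' _ md => //; left.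
have [D md] := three_multiflip_data tT h.
by apply: data_rescaling cA cA' _ md => //; right.
Qed.

Lemma rescaling_multiflip (R : realType) n (lam : R) (T T' : {set {set 'I_n.+3}}) A A' :
  triangulation T -> triangulation T' -> corresponds T A -> corresponds T' A' ->
  0 < lam -> lam != 1 -> is_rescaling n lam A A' -> multiflip T T'.
Proof.
move=> tT tT' cA cA' l0 l1 hr; have [on _] := hr.
pose mu := if 1 < lam then lam else lam^-1.
have mu1 : 1 < mu.
  rewrite /mu; case: ifPn => //; rewrite -leNgt invf_gt1 // => le.
  by rewrite lt_neqAle l1.
(* The parity class between whose vertices the lengths are multiplied by [mu]. *)
pose S := [set v : 'I_n.+3 | odd v == (1 < lam)].
have altS : alternating S by apply: alternating_odd.
have [] := @rescaled_multiflip_data n R mu T T' A A' S tT tT' cA cA' altS mu1 _ _ _.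
- move=> a b; rewrite !inE => hab; apply/eqP.
  rewrite -(eqr_int R) (is_rescaling_len a b hr) ifF ?mul1r //.
  by move: hab; case: (1 < lam); case: (odd a); case: (odd b).
- move=> a b; rewrite !inE => /eqP ha /eqP hb.
  by rewrite (is_rescaling_len a b hr) ha hb eqxx.
- move=> a b; rewrite !inE => ha hb; rewrite (is_rescaling_len a b hr) /mu mulrA.
  have -> : odd a = ~~ (1 < lam) by move: ha; case: (odd a); case: (1 < lam).
  have -> : odd b = ~~ (1 < lam) by move: hb; case: (odd b); case: (1 < lam).
  by rewrite eqxx; case: (1 < lam) => /=; rewrite ?divff ?mulVf ?mul1r ?lt0r_neq0.
move=> m [[->|->] md].
  by left; apply: data_two md _ => //; apply: triangulation_dissection.
by right; apply: data_three md _ => //; apply: triangulation_dissection.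
Qed.

Theorem theorem13 (R : realType) (n : nat) (T1 T2 : {set {set 'I_n.+3}})
    (A1 A2 : int -> int -> int)
    (hT1 : triangulation T1) (hT2 : triangulation T2)
    (hA1 : corresponds T1 A1) (hA2 : corresponds T2 A2) :
  multiflip_related T1 T2 <->
  exists lam : R, [/\ 0 < lam, lam != 1 & rescaling_related n lam A1 A2].
Proof.
split=> [[h|h]|[lam [l0 l1 [h|h]]]].
- by have [lam [l0 l1 hr]] := multiflip_rescaling R hT1 hT2 hA1 hA2 h; exists lam; split=> //; left.
- by have [lam [l0 l1 hr]] := multiflip_rescaling R hT2 hT1 hA2 hA1 h; exists lam; split=> //; right.
- by left; apply: rescaling_multiflip h.
- by right; apply: rescaling_multiflip h.
Qed.
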